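(* Let $1 < r < \infty$ and $\alpha = \frac{1}{r}$. Then the Riesz potential $I_\alpha$ maps $L_r(\mathfrak{X})$ to $\mathrm{BMO}(\mathfrak{X}, \{\mathcal{F}_n\})$ continuously. In other words, there is a constant $C = C(r)$, depending only on $r$, such that for all functions $F \in L_r(\mathfrak{X})$ the series $$I_\alpha[F] = \sum_{n=1}^\infty M_n(E_n - E_{n-1})F$$ converges in $\mathrm{BMO}(\mathfrak{X}, \{\mathcal{F}_n\})$ and the inequality $$\|I_\alpha[F]\|_{\mathrm{BMO}} \leq C\|F\|_r$$ holds.
   Context: $\mathfrak{X} = (\Omega, \mathcal{F}, \mathbb{P})$ is a probability space with a sequence of sigma-algebras $\mathcal{F}_0 \subset \mathcal{F}_1 \subset \dots \subset \mathcal{F}$ such that: for any two distinct points $\omega_1, \omega_2 \in \Omega$ there are $n$ and $X \in \mathcal{F}_n$ with $\omega_1 \in X$, $\omega_2 \notin X$; $\mathcal{F}_0 = \{\varnothing, \Omega\}$; and each $\mathcal{F}_n$ is generated by a finite or countable set of atoms, i.e. there is a finite or countable partition $\Omega = \bigsqcup_j a_j$ such that $\mathcal{F}_n$ is generated by the events $a_j$ (called the atoms of $\mathcal{F}_n$). Operators: $E_n f = \mathbb{E}(f \mid \mathcal{F}_n)$. For a parameter $\alpha \in [0,1)$, $[M_n f](\omega) = b_n^\alpha(\omega) f(\omega)$, where $b_n(\omega) = \mathbb{P}(a)$ and $a$ is the atom of $\mathcal{F}_n$ containing $\omega$. The Riesz potential is $I_\alpha[F] = \sum_{n=1}^\infty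 M_n(E_n - E_{n-1})F$. BMO: for an integrable random variable $F$, with associated martingale $F_n = \mathbb{E}(F\mid\mathcal{F}_n)$, put $$\|F\|_{\mathrm{BMO}} = \sup_{n=0,1,\dots}\ \sup_{a} \left(\mathbb{E}\big((F - \mathbb{E}(F_n \mid a))^2 \mid a\big)\right)^{1/2},$$ where $a$ runs over the atoms of $\mathcal{F}_n$ of positive probability and $\mathbb{E}(\cdot\mid a)$ denotes the conditional expectation given the event $a$, i.e. $\frac{1}{\mathbb{P}(a)}\int_a \cdot\, d\mathbb{P}$. The space $\mathrm{BMO}(\mathfrak{X},\{\mathcal{F}_n\})$ consists of those $F$ for which this seminorm is finite; convergence in BMO means convergence with respect to this seminorm. *)

(* Defs.v *)
From HB Require Import structures.
From mathcomp Require Import all_boot all_order all_algebra.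
From mathcomp Require Import all_classical all_reals all_analysis.

Set Implicit Arguments.
Unset Strict Implicit.
Unset Printing Implicit Defensive.

Import Order.TTheory GRing.Theory Num.Theory.
Import numFieldNormedType.Exports.

Local Open Scope classical_set_scope.
Local Open Scope ring_scope.

(* [At n] is the set of atoms of the sigma-algebra [Fs n]. *)
Record atomic_filtration d (T : measurableType d)
    (Fs At : nat -> set_system T) : Prop := AtomicFiltration {
  filtration_measurable : forall n, Fs n `<=` measurable ;
  filtration_nondecreasing : forall n, Fs n `<=` Fs n.+1 ;
  filtration0 : Fs 0%N = [set set0; setT] ;
  filtration_separates : forall w1 w2 : T, w1 <> w2 ->
    exists n X, [/\ Fs n X, X w1 & ~ X w2] ;
  atoms_countable : forall n, countable (At n) ;
  atoms_partition : forall n, partition (At n) id setT ;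
  atoms_generate : forall n, Fs n = <<s At n >> }.

Section Operators.
Context d (T : measurableType d) (R : realType) (P : probability T R).

Local Open Scope ereal_scope.

(* [g] is a version of the conditional expectation of [f] given [G]; the first
   clause is measurability with respect to [G] rather than to the ambient
   sigma-algebra. *)
Definition is_condexp (G : set_system T) (f g : T -> R) : Prop :=
  [/\ preimage_set_system setT g measurable `<=` G,
      P.-integrable setT (EFin \o g)
    & forall B, G B -> \int[P]_(x in B) (g x)%:E = \int[P]_(x in B) (f x)%:E].

(* An arbitrary version; the value 0 is used only when there is none, which
   cannot happen for integrable [f]. *)
Definition condexp (G : set_system T) (f : T -> R) : T -> R :=
  xget (cst 0%R) [set g | is_condexp G f g].

Definition condexp_event (a : set T) (f : T -> R) : \bar R :=
  (\int[P]_(x in a) (f x)%:E) / P a.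

(* [pblock (At n) id w] is the atom of level [n] containing [w]. *)
Definition atom_prob (At : nat -> set_system T) (n : nat) (w : T) : R :=
  fine (P (pblock (At n) id w)).

Definition Mop (alpha : R) (At : nat -> set_system T) (n : nat) (f : T -> R) :
    T -> R :=
  fun w => (atom_prob At n w `^ alpha * f w)%R.

Definition riesz_partial (alpha : R) (Fs At : nat -> set_system T)
    (F : T -> R) (N : nat) : T -> R :=
  (\sum_(1 <= n < N.+1)
     Mop alpha At n (condexp (Fs n) F \- condexp (Fs n.-1) F))%R.

Definition bmo_norm (Fs At : nat -> set_system T) (F : T -> R) : \bar R :=
  ereal_sup (range (fun n =>
    ereal_sup [set sqrte (condexp_event a (fun w =>
                 (F w - fine (condexp_event a (condexp (Fs n) F))) ^+ 2)%R)
              | a in [set a | At n a /\ 0 < P a]])).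

Definition BMO (Fs At : nat -> set_system T) : set (T -> R) :=
  [set F | P.-integrable setT (EFin \o F) /\ bmo_norm Fs At F < +oo].

Definition bmo_cvg (Fs At : nat -> set_system T) (u : nat -> T -> R)
    (G : T -> R) : Prop :=
  [/\ forall N, BMO Fs At (u N), BMO Fs At G
    & (fun N => bmo_norm Fs At (u N \- G)%R) @ \oo --> 0].

End Operators.

(* Main.v *)
Require Import Defs.
From mathcomp Require Import all_boot all_order all_algebra.
From mathcomp Require Import all_classical all_reals all_analysis.
From mathcomp Require Import measurable_realfun lra.

Set Implicit Arguments.
Unset Strict Implicit.
Unset Printing Implicit Defensive.

Import Order.TTheory GRing.Theory Num.Theory.
Import numFieldNormedType.Exports.

Local Open Scope classical_set_scope.
Local Open Scope ring_scope.

(* Write |a| for P(a), phi(a) for the L_r norm of F on a, and, for a child c of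
   an atom a, v(a,c) = |c|^(1/r) |mean_c F - mean_a F|.  The function phi of the
   current atom is a supermartingale, and its expected decrease dominates the
   variation:
     sum_c |c| v(a,c) <= C (|a| phi(a) - sum_c |c| phi(c)),
   the sum being over the children of a.
   By Hoelder v(a,c) <= 2 phi(a), and Young's inequality bounds |c| phi(c) by
   (|c|/|a|)^(1/r) times the share of c in a weight of total mass |a| phi(a), so
   every child with at most half of |a| leaves a definite loss.  The possible
   child with more than half moves the mean only through the other children, so
   their loss pays for it too.  Iterating down the tree, the total variation S
   below a satisfies E(S | a) <= C phi(a) and E(S^2 | a) <= K phi(a)^2.

   As S depends on F only up to a constant, phi(a) may be replaced by
   inf_c ||F - c||_(L_r(a)).  This tends to 0 uniformly over the atoms of level
   n: the atoms containing a given point w shrink to {w}, so (take c = F(w)) the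
   union of the bad atoms of level n decreases to the empty set, whereas it
   carries a fixed amount of |F|^r as long as it is nonempty.  Hence the partial
   sums, which converge absolutely almost everywhere, converge in BMO. *)

(** * Splitting an atom: real inequalities *)

Section RealInequalities.
Context {R : realType} (al : R).
Hypotheses (al_gt0 : 0 < al) (al_lt1 : al < 1).
Implicit Types x y p q : R.

Lemma young_powR x y : 0 <= x -> 0 <= y ->
  x `^ (1 - al) * y `^ al <= (1 - al) * x + al * y.
Proof.
move=> x0 y0.
have al'_gt0 : 0 < 1 - al by rewrite subr_gt0.
have := @conjugate_powR R (x `^ (1 - al)) (y `^ al) (1 - al)^-1 al^-1
  (powR_ge0 _ _) (powR_ge0 _ _).
rewrite !invr_gt0 !invrK => /(_ al'_gt0 al_gt0).
rewrite subrK => /(_ erefl).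
rewrite -!powRrM !mulfV ?gt_eqF// !powRr1//.
by rewrite ![_ * (1 - al)]mulrC ![y * _]mulrC.
Qed.

Lemma powR_splitl x : 0 <= x -> x `^ al * x `^ (1 - al) = x.
Proof.
move=> x0; rewrite -powRD; first by rewrite addrC subrK powRr1.
by rewrite addrC subrK oner_eq0.
Qed.

(* For a child of relative probability [p] carrying the fraction [q] of the
   [L_r]-mass of its parent; these weights add up to at most 1. *)
Definition weight p q := (1 - al) * p + al * q.

Lemma weight_ge0 p q : 0 <= p -> 0 <= q -> 0 <= weight p q.
Proof.
have [h0 h1] := (al_gt0, al_lt1).
by move=> p0 q0; rewrite /weight addr_ge0// mulr_ge0//; lra.
Qed.

(** Young's inequality bounds [p^(1-al) * q^al] by the weight. The remaining factor [p^al] is the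
    gain: it is at most [2^-al] for a child with at most half of its parent. *)
Lemma child_weight p q : 0 <= p -> 0 <= q ->
  p * q `^ al <= p `^ al * weight p q.
Proof.
move=> p0 q0; rewrite -{1}(powR_splitl p0) -mulrA.
by rewrite ler_wpM2l ?powR_ge0 ?young_powR.
Qed.

(** For a child of weight [w], [1 - p <= (1 - w) / (1 - al)], so [v <= (1 - p) + (1 - w)] becomes
    [v <= step1 * (1 - w)]. *)
Definition step1 : R := (1 - al)^-1 + 1.
(** The solution [C] of [C * (1 - 2^-al) = 2 / (1 - al) + step1], which is what a child with
    [p <= 1/2] requires in [child_bound]. *)
Definition step_cst : R := (3 * (1 - al)^-1 + 1) / (1 - 2^-1 `^ al).

Lemma half_powR_lt1 : 2^-1 `^ al < 1 :> R.
Proof.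
have := @gt0_ltr_powR R al al_gt0 2^-1 1; rewrite powR1; apply.
- by rewrite nnegrE; lra.
- by rewrite nnegrE; lra.
- by lra.
Qed.

Lemma inv1al_gt1 : 1 < (1 - al)^-1.
Proof. by have [h0 h1] := (al_gt0, al_lt1); rewrite invf_gt1 ?subr_gt0 ?gtrBl. Qed.

Lemma step_cstE :
  step_cst = 3 * (1 - al)^-1 + 1 + step_cst * 2^-1 `^ al.
Proof.
have k0 : 1 - 2^-1 `^ al != 0 by rewrite gt_eqF// subr_gt0 half_powR_lt1.
rewrite -[in LHS](subrK (step_cst * 2^-1 `^ al) step_cst).
by rewrite -{1}(mulr1 step_cst) -mulrBr /step_cst mulfVK.
Qed.

Lemma step_cst_gt0 : 0 < step_cst.
Proof.
rewrite divr_gt0 ?subr_gt0 ?half_powR_lt1//.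
by have := inv1al_gt1; lra.
Qed.

Lemma step1_le : 0 <= step_cst - step1.
Proof.
have := step_cstE; have := inv1al_gt1; have := step_cst_gt0.
have := @powR_ge0 R 2^-1 al => h1 h2 h3 ->; rewrite /step1.
by have := mulr_ge0 (ltW h2) h1; lra.
Qed.

(* [v] is the normalised increment.  At most one child has more than half of
   the probability of its parent; that child pays for the whole remainder. *)
Lemma child_bound p q v : 0 <= p <= 1 -> 0 <= q <= 1 -> 0 <= v ->
  v <= 2 ->
  (2^-1 < p -> v <= (1 - p) + (1 - weight p q)) ->
  p * v + step_cst * (p * q `^ al) <=
  (step_cst - step1) * weight p q + (2^-1 < p)%R%:R * step1.
Proof.
have [h0 h1] := (al_gt0, al_lt1).
move=> /andP[p0 p1] /andP[q0 q1] v0 v2 vlarge.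
have al'_gt0 : 0 < 1 - al by rewrite subr_gt0.
have C0 := step_cst_gt0; have i1 := inv1al_gt1.
have w0 := weight_ge0 p0 q0.
have pw : p <= (1 - al)^-1 * weight p q.
  rewrite mulrC ler_pdivlMr// /weight mulrC lerDl mulr_ge0//; lra.
have cw := child_weight p0 q0.
case: ltP vlarge => [ph|ph] vlarge; rewrite /= ?mul1r ?mul0r ?addr0.
  (* Large child: the left-hand side is at most [step_cst * w + step1 * (1 - w)], where [w] is the
     weight, and this equals the right-hand side. *)
  have {vlarge} := vlarge erefl => vl.
  have pw1 : p * q `^ al <= weight p q.
    apply: le_trans cw _; rewrite ler_piMl//.
    have := @ge0_ler_powR R al (ltW al_gt0) p 1; rewrite powR1; apply => //.
    by rewrite nnegrE.
  have dw : 1 - p <= (1 - al)^-1 * (1 - weight p q).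
    rewrite mulrC ler_pdivlMr// /weight.
    have : 0 <= al * (1 - q) by rewrite mulr_ge0//; lra.
    lra.
  have pv : p * v <= v by rewrite ler_piMl.
  have := ler_wpM2l (ltW C0) pw1.
  rewrite /step1; move: (weight p q) dw vl => w dw vl.
  by move: ((1 - al)^-1) dw => i dw; lra.
(* Small child: [p * v <= 2 * w / (1 - al)], while the other term shrinks by the factor [2^-al];
   [step_cstE] balances the two. *)
have pha : p `^ al <= 2^-1 `^ al.
  by apply: ge0_ler_powR; rewrite ?nnegrE ?(ltW al_gt0)//; lra.
have pw1 : p * q `^ al <= 2^-1 `^ al * weight p q.
  by apply: le_trans cw _; rewrite ler_wpM2r.
have pv : p * v <= 2 * ((1 - al)^-1 * weight p q) by nra.
have := ler_wpM2l (ltW C0) pw1.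
have : step_cst * weight p q =
    (3 * (1 - al)^-1 + 1 + step_cst * 2^-1 `^ al) * weight p q.
  by rewrite -step_cstE.
have i0 : 0 <= (1 - al)^-1 by lra.
have iw := mulr_ge0 i0 w0.
by rewrite /step1; lra.
Qed.

(** The weights sum to at most 1 and at most one [p i] exceeds 1/2, so summing [child_bound] gives
    at most [(step_cst - step1) + step1]; [step1_le] supplies the sign of the first coefficient. *)
Lemma sum_child_bound (p q v : nat -> R) (n : nat) :
  (forall i, 0 <= p i <= 1) -> (forall i, 0 <= q i <= 1) ->
  (forall i, 0 <= v i <= 2) ->
  (forall i, 2^-1 < p i -> v i <= (1 - p i) + (1 - weight (p i) (q i))) ->
  \sum_(0 <= i < n) p i <= 1 -> \sum_(0 <= i < n) q i <= 1 ->
  \sum_(0 <= i < n) (p i * v i + step_cst * (p i * q i `^ al)) <= step_cst.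
Proof.
have [h0 h1] := (al_gt0, al_lt1).
move=> p01 q01 v02 vl sp sq.
have C1 := step1_le; have i1 := inv1al_gt1.
apply: (@le_trans _ _ (\sum_(0 <= i < n)
    ((step_cst - step1) * weight (p i) (q i) + (2^-1 < p i)%R%:R * step1))).
  apply: ler_sum => i _; have /andP[v0 v2] := v02 i.
  by apply: child_bound => //; exact: vl.
rewrite big_split/= -mulr_sumr -mulr_suml.
have sw : \sum_(0 <= i < n) weight (p i) (q i) <= 1.
  rewrite big_split/= -!mulr_sumr.
  have : (1 - al) * \sum_(0 <= i < n) p i <= 1 - al by rewrite ler_piMr//; lra.
  have : al * \sum_(0 <= i < n) q i <= al by rewrite ler_piMr//; lra.
  lra.
have sl : \sum_(0 <= i < n) (2^-1 < p i)%R%:R <= 1 :> R.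
  rewrite big_mkord; rewrite big_mkord in sp.
  have [[j pj]|none] := pselect (exists j : 'I_n, 2^-1 < p j); last first.
    rewrite big1 ?ler01// => i _; case: ltP => // pi.
    by case: none; exists i.
  rewrite (bigD1 j)//= pj big1 ?addr0// => i ij; case: ltP => // pi.
  move: sp; rewrite (bigD1 j)//= (bigD1 i)//=.
  have : 0 <= \sum_(k < n | (k != j) && (k != i)) p k.
    by apply: sumr_ge0 => k _; have /andP[] := p01 k.
  lra.
have : (step_cst - step1) * \sum_(0 <= i < n) weight (p i) (q i) <=
  step_cst - step1 by rewrite ler_piMr.
have : (\sum_(0 <= i < n) (2^-1 < p i)%R%:R) * step1 <= step1.
  by rewrite ler_piMl// /step1; lra.
lra.
Qed.

End RealInequalities.

(** * Local L_r norms *)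

Section LocalNorms.
Context d (T : measurableType d) (R : realType) (P : probability T R) (r : R).
Implicit Types (F : T -> R) (A B : set T).

Definition pr A : R := fine (P A).
Definition lpow F A : R := \int[P]_(x in A) (`|F x| `^ r).
Definition lnrm F A : R := lpow F A `^ r^-1.
Definition mean F A : R := (\int[P]_(x in A) F x) / pr A.

Lemma pr_ge0 A : 0 <= pr A.
Proof. exact: fine_ge0. Qed.

Lemma prE A : measurable A -> (pr A)%:E = P A.
Proof. by move=> mA; rewrite fineK ?fin_num_measure. Qed.

Lemma le_pr A B : measurable A -> measurable B -> A `<=` B -> pr A <= pr B.
Proof.
by move=> mA mB AB; rewrite -lee_fin !prE// le_measure// inE.
Qed.

Lemma lpow_ge0 F A : 0 <= lpow F A.
Proof. by apply: Rintegral_ge0 => x _; exact: powR_ge0. Qed.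

Lemma lnrm_ge0 F A : 0 <= lnrm F A.
Proof. exact: powR_ge0. Qed.

Hypothesis r_gt1 : 1 < r.

Let r_gt0 : 0 < r. Proof. exact: lt_trans r_gt1. Qed.

Definition Lr F := measurable_fun setT F /\
  P.-integrable setT (fun x => (`|F x| `^ r)%:E).

(** On a probability space [1 + |F|^r] is integrable, and it dominates [|F|]. *)
Lemma Lr_integrable F : Lr F -> P.-integrable setT (EFin \o F).
Proof.
move=> [mF iF].
apply: (@le_integrable _ _ _ _ _ _ _ (fun x => (1 + `|F x| `^ r)%:E)) => //.
- exact/measurable_EFinP.
- move=> x _ /=; rewrite lee_fin (ger0_norm (addr_ge0 ler01 (powR_ge0 _ _))).
  have [F1|F1] := leP `|F x| 1; first by rewrite (le_trans F1)// lerDl powR_ge0.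
  by rewrite (le_trans (le1r_powR (ltW F1) (ltW r_gt1)))// lerDr.
- have := integrableD measurableT (finite_measure_integrable_cst P 1 measurableT) iF.
  exact: eq_integrable.
Qed.

Lemma Lr_integrableS F A : Lr F -> measurable A ->
  P.-integrable A (EFin \o F).
Proof. by move=> /Lr_integrable iF mA; apply: integrableS iF. Qed.

Lemma lpow_integrableS F A : Lr F -> measurable A ->
  P.-integrable A (fun x => (`|F x| `^ r)%:E).
Proof. by move=> [_ iF] mA; apply: integrableS iF. Qed.

Lemma lpowE F A : Lr F -> measurable A ->
  (lpow F A)%:E = (\int[P]_(x in A) (`|F x| `^ r)%:E)%E.
Proof.
move=> LF mA; rewrite /lpow /Rintegral fineK//.
exact/integrable_fin_num/lpow_integrableS.
Qed.

Lemma le_lpow F A B : Lr F -> measurable A -> measurable B -> A `<=` B ->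
  lpow F A <= lpow F B.
Proof.
move=> LF mA mB AB; rewrite -lee_fin !lpowE//.
apply: ge0_subset_integral => //.
by have /integrableP[] := lpow_integrableS LF mB.
Qed.

Lemma le_lnrm F A B : Lr F -> measurable A -> measurable B -> A `<=` B ->
  lnrm F A <= lnrm F B.
Proof.
move=> LF mA mB AB; apply: ge0_ler_powR; rewrite ?nnegrE ?lpow_ge0//.
  by rewrite invr_ge0 ltW.
exact: le_lpow.
Qed.

(** Hoelder's inequality for the restriction of [F] to [A] and the indicator of [A], with exponents
    [r] and [q = 1 / (1 - 1/r)]. *)
Lemma hoelder_on F A : Lr F -> measurable A ->
  \int[P]_(x in A) `|F x| <= pr A `^ (1 - r^-1) * lnrm F A.
Proof.
move=> LF mA; have [mF iF] := LF.
pose q := (1 - r^-1)^-1.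
have i1 : r^-1 < 1 by rewrite invf_lt1.
have q0 : 0 < q by rewrite invr_gt0 subr_gt0.
have mFA : measurable_fun setT (F \_ A).
  exact/(measurable_restrictT _ mA).1/measurable_funTS.
have m1A : measurable_fun setT (\1_A : T -> R) by exact: measurable_indic.
have := hoelder P mFA m1A r_gt0 q0.
rewrite /q invrK addrC subrK => /(_ erefl).
rewrite -/q Lnorm1.
have -> : (\int[P]_x `|(EFin \o ((F \_ A) \* \1_A)%R) x| =
    \int[P]_(x in A) (`|F x|)%:E)%E.
  rewrite [RHS]integral_mkcond; apply: eq_integral => x _ /=.
  rewrite /patch indicE; case: ifPn => xA /=; first by rewrite mulr1.
  by rewrite mulr0 normr0.
have -> : ('N[P]_r%:E[EFin \o (F \_ A)] = (lnrm F A)%:E)%E.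
  rewrite unlock /lnrm -poweR_EFin (lpowE LF mA); congr poweR.
  rewrite [RHS]integral_mkcond; apply: eq_integral => x _ /=.
  rewrite /patch; case: ifPn => xA //=.
  by rewrite normr0 powR0// gt_eqF.
have -> : ('N[P]_q%:E[EFin \o \1_A] = (pr A `^ (1 - r^-1))%:E)%E.
  rewrite unlock -poweR_EFin /q invrK prE//; congr poweR.
  have := @integral_indic _ _ _ P setT measurableT A mA.
  rewrite setIT => <-.
  apply: eq_integral => x _ /=; rewrite indicE; case: (x \in A) => /=.
    by rewrite normr1 powR1.
  by rewrite normr0 powR0// gt_eqF.
rewrite -EFinM mulrC => h; rewrite -lee_fin; apply: le_trans h.
rewrite fineK//; apply: integrable_fin_num => //.
by apply: integrable_norm; exact: Lr_integrableS.
Qed.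

Lemma norm_int_le F A : Lr F -> measurable A ->
  `|\int[P]_(x in A) F x| <= pr A `^ (1 - r^-1) * lnrm F A.
Proof.
move=> LF mA; apply: le_trans (hoelder_on LF mA).
exact/le_normr_Rintegral/Lr_integrableS.
Qed.

(** Hoelder's inequality divided by [pr A]. The power [1/r] left over is the one carried by the
    Riesz potential, which is why [alpha = 1/r] fits [L_r]. *)
Lemma pr_mean_le F A : Lr F -> measurable A ->
  pr A `^ r^-1 * `|mean F A| <= lnrm F A.
Proof.
move=> LF mA; have [->|pA0] := eqVneq (pr A) 0.
  by rewrite powR0 ?mul0r ?powR_ge0// invr_neq0// gt_eqF.
have p0 : 0 < pr A by rewrite lt_neqAle eq_sym pA0 pr_ge0.
rewrite /mean normrM normfV (ger0_norm (pr_ge0 _)) mulrA ler_pdivrMr//.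
apply: le_trans (ler_wpM2l (powR_ge0 _ _) (norm_int_le LF mA)) _.
rewrite mulrA -powRD; last by rewrite pA0 implybT.
by rewrite addrC subrK powRr1 ?pr_ge0// mulrC.
Qed.

End LocalNorms.

(** * Splitting an atom: one generation *)

Section OneStep.
Context d (T : measurableType d) (R : realType) (P : probability T R).

Lemma sum_integral_le (f : T -> \bar R) (a : set T) (c : nat -> set T) n :
  measurable a -> (forall i, measurable (c i)) -> trivIset setT c ->
  (forall i, c i `<=` a) -> measurable_fun a f ->
  (forall x, a x -> 0 <= f x)%E ->
  (\sum_(0 <= i < n) \int[P]_(x in c i) f x <= \int[P]_(x in a) f x)%E.
Proof.
move=> ma mc tc ca mf f0.
have sub : \big[setU/set0]_(0 <= i < n) c i `<=` a.
  by rewrite big_mkord => x; rewrite -bigcup_mkord => -[i _] /ca.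
rewrite -ge0_integral_bigsetU ?iota_uniq//.
- apply: ge0_subset_integral => //; exact: bigsetU_measurable.
- exact: sub_trivIset tc.
- exact: measurable_funS mf.
- by move=> x /sub /f0.
Qed.

Lemma sum_pr_le (a : set T) (c : nat -> set T) n :
  measurable a -> (forall i, measurable (c i)) -> trivIset setT c ->
  (forall i, c i `<=` a) -> \sum_(0 <= i < n) pr P (c i) <= pr P a.
Proof.
move=> ma mc tc ca; rewrite -lee_fin -sumEFin.
have e X : measurable X -> (\int[P]_(x in X) 1 = (pr P X)%:E)%E.
  by move=> mX; rewrite integral_cst// mul1e prE.
have := @sum_integral_le (cst 1%E) a c n ma mc tc ca.
rewrite e// (eq_bigr (fun i => (pr P (c i))%:E)); first by apply.
by move=> i _; rewrite e.
Qed.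

Context (r : R).
Hypothesis r_gt1 : 1 < r.
Variable F : T -> R.
Hypothesis LF : Lr P r F.
Let al := r^-1.
Let al_gt0 : 0 < al.
Proof. by rewrite invr_gt0 (lt_trans _ r_gt1). Qed.
Let al_lt1 : al < 1.
Proof. by rewrite invf_lt1// (lt_trans _ r_gt1). Qed.

(** For a child [c] of an atom [a], the absolute value on [c] of a term of the Riesz series; hence
    the power of the probability of the child, not of the parent. *)
Definition incr (a c : set T) : R := pr P c `^ al * `|mean P F c - mean P F a|.

Lemma incr_ge0 a c : 0 <= incr a c.
Proof. by rewrite mulr_ge0 ?powR_ge0. Qed.

Lemma incr_le2 a c : measurable a -> measurable c -> c `<=` a ->
  incr a c <= 2 * lnrm P r F a.
Proof.
move=> ma mc ca.
have hc := pr_mean_le r_gt1 LF mc; have ha := pr_mean_le r_gt1 LF ma.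
have hca := le_lnrm r_gt1 LF mc ma ca.
have pca : pr P c `^ al <= pr P a `^ al.
  by rewrite ge0_ler_powR ?nnegrE ?pr_ge0 ?(ltW al_gt0)// le_pr.
apply: (@le_trans _ _ (pr P c `^ al * (`|mean P F c| + `|mean P F a|))).
  by rewrite ler_wpM2l ?powR_ge0// ler_normB.
have pma := le_trans (ler_wpM2r (normr_ge0 (mean P F a)) pca) ha.
rewrite mulrDr; apply: le_trans (lerD hc pma) _.
by rewrite mulr_natl mulr2n lerD2r.
Qed.

(** Only the complement of [c] moves the mean: [mean c - mean a = mean c * (1 - p) - (integral of F
    over a \ c) / pr a]. The first term is bounded by [pr_mean_le], the second by Hoelder on [a \ c]
    and Young for [1 - p] and [1 - q]. *)
Lemma incr_le_rest a c : measurable a -> measurable c -> c `<=` a ->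
  0 < pr P a -> 0 < lpow P r F a ->
  incr a c <= lnrm P r F a * ((1 - pr P c / pr P a) +
    (1 - weight al (pr P c / pr P a) (lpow P r F c / lpow P r F a))).
Proof.
move=> ma mc ca pa la.
have mac : measurable (a `\` c) by exact: measurableD.
have acE : a = c `|` (a `\` c) by rewrite setDUK.
have dj : [disjoint c & a `\` c].
  by apply/disj_setPS => x [cx [_ /(_ cx)]].
have prac : pr P (a `\` c) = pr P a - pr P c.
  apply: EFin_inj; rewrite EFinB !prE// measureD//.
    by rewrite (setIidr ca).
  by rewrite ltey_eq fin_num_measure.
have lpac : lpow P r F (a `\` c) = lpow P r F a - lpow P r F c.
  rewrite {2}acE /lpow Rintegral_setU// -?acE; first by rewrite addrAC subrr add0r.
  exact: lpow_integrableS.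
have iac : \int[P]_(x in a) F x =
    \int[P]_(x in c) F x + \int[P]_(x in (a `\` c)) F x.
  by rewrite {1}acE Rintegral_setU// -?acE; apply: Lr_integrableS LF _ => //.
have pca := le_pr P mc ma ca.
have lca := le_lpow LF mc ma ca.
set p := pr P c / pr P a; set q := lpow P r F c / lpow P r F a.
have p1 : p <= 1 by rewrite ler_pdivrMr// mul1r.
have q1 : q <= 1 by rewrite ler_pdivrMr// mul1r.
have wE : 1 - weight al p q = (1 - al) * (1 - p) + al * (1 - q).
  by rewrite /weight; lra.
have w1 : 0 <= 1 - weight al p q.
  by rewrite wE addr_ge0// mulr_ge0 ?subr_ge0// ltW.
(* A null child is set apart because the formula for the difference of means cancels [pr P c]. *)
have [pc0|pc0] := eqVneq (pr P c) 0.
  rewrite /incr pc0 powR0 ?mul0r ?gt_eqF//.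
  by rewrite mulr_ge0 ?lnrm_ge0// addr_ge0// subr_ge0.
have pc : 0 < pr P c by rewrite lt_neqAle eq_sym pc0 pr_ge0.
have mE : mean P F c - mean P F a =
    mean P F c * (1 - p) - (\int[P]_(x in (a `\` c)) F x) / pr P a.
  rewrite /mean iac mulrDl mulrBr mulr1 opprD addrA; congr (_ - _ - _).
  by rewrite /p mulrA mulfVK.
have al1 : 0 <= 1 - al by rewrite subr_ge0 ltW.
apply: (@le_trans _ _ (pr P c `^ al * `|mean P F c| * (1 - p) +
    pr P c `^ al * `|\int[P]_(x in (a `\` c)) F x| / pr P a)).
  have eqs (x y z t u : R) : x * y * z + x * t * u = x * (y * z + t * u).
    by rewrite mulrDr !mulrA.
  rewrite eqs.
  rewrite /incr mE ler_wpM2l ?powR_ge0//.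
  rewrite (le_trans (ler_normB _ _))// lerD//.
    by rewrite (@normrM _ (mean P F c)) (@ger0_norm _ (1 - p)) ?subr_ge0.
  rewrite (@normrM _ (\int[P]_(x in (a `\` c)) F x)) (normfV (pr P a)).
  rewrite (ger0_norm (ltW pa)).
  exact: lexx.
rewrite [leRHS]mulrDr lerD//.
  rewrite ler_wpM2r ?subr_ge0// (le_trans (pr_mean_le r_gt1 LF mc))//.
  exact: le_lnrm.
rewrite wE ler_pdivrMr//.
apply: le_trans (ler_wpM2l (powR_ge0 _ _) (norm_int_le r_gt1 LF mac)) _.
have -> : pr P (a `\` c) = pr P a * (1 - p).
  by rewrite prac mulrBr mulr1 /p mulrCA divff ?mulr1 ?gt_eqF.
have -> : lnrm P r F (a `\` c) = lnrm P r F a * (1 - q) `^ al.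
  rewrite /lnrm -powRM ?subr_ge0 ?lpow_ge0//; congr (_ `^ _).
  by rewrite lpac mulrBr mulr1 /q mulrCA divff ?mulr1 ?gt_eqF.
rewrite powRM ?subr_ge0 ?pr_ge0//.
have pca' : pr P c `^ al <= pr P a `^ al.
  by rewrite ge0_ler_powR ?nnegrE ?pr_ge0 ?(ltW al_gt0).
have yg : (1 - p) `^ (1 - al) * (1 - q) `^ al <=
    (1 - al) * (1 - p) + al * (1 - q).
  by apply: young_powR; rewrite ?subr_ge0.
have e : pr P a `^ al * pr P a `^ (1 - al) = pr P a.
  by apply: powR_splitl; rewrite ?pr_ge0.
rewrite -[X in _ <= _ * X]e.
have -> : pr P c `^ al * (pr P a `^ (1 - al) * (1 - p) `^ (1 - al) *
   (lnrm P r F a * (1 - q) `^ al)) = (pr P c `^ al * pr P a `^ (1 - al)) *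
   lnrm P r F a * ((1 - p) `^ (1 - al) * (1 - q) `^ al) by lra.
have -> : lnrm P r F a * ((1 - al) * (1 - p) + al * (1 - q)) *
    (pr P a `^ al * pr P a `^ (1 - al)) = (pr P a `^ al * pr P a `^ (1 - al)) *
   lnrm P r F a * ((1 - al) * (1 - p) + al * (1 - q)) by lra.
rewrite ler_pM ?mulr_ge0 ?powR_ge0 ?lnrm_ge0//.
by rewrite ler_wpM2r ?lnrm_ge0// ler_wpM2r ?powR_ge0.
Qed.

Lemma one_step a (c : nat -> set T) n :
  measurable a -> (forall i, measurable (c i)) -> trivIset setT c ->
  (forall i, c i `<=` a) -> 0 < pr P a ->
  \sum_(0 <= i < n) (pr P (c i) * incr a (c i) +
     step_cst al * (pr P (c i) * lnrm P r F (c i))) <=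
  step_cst al * (pr P a * lnrm P r F a).
Proof.
move=> ma mc tc ca pa.
(* Without [L_r]-mass on [a] every term is 0; otherwise dividing by [pr a * lnrm a] reduces the
   claim to [sum_child_bound]. *)
have [la0|la0] := eqVneq (lpow P r F a) 0.
  have Fa0 : lnrm P r F a = 0 by rewrite /lnrm la0 powR0 ?gt_eqF.
  rewrite big1 ?Fa0 ?mulr0// => i _.
  have -> : lnrm P r F (c i) = 0.
    by apply/eqP; rewrite eq_le lnrm_ge0 andbT -Fa0 le_lnrm.
  have -> : incr a (c i) = 0.
    apply/eqP; rewrite eq_le incr_ge0 andbT.
    by have := incr_le2 ma (mc i) (ca i); rewrite Fa0 mulr0.
  by rewrite !mulr0 addr0.
have la : 0 < lpow P r F a by rewrite lt_neqAle eq_sym la0 lpow_ge0.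
have Fa : 0 < lnrm P r F a by rewrite powR_gt0.
pose p i := pr P (c i) / pr P a.
pose q i := lpow P r F (c i) / lpow P r F a.
pose v i := incr a (c i) / lnrm P r F a.
have -> : \sum_(0 <= i < n) (pr P (c i) * incr a (c i) +
     step_cst al * (pr P (c i) * lnrm P r F (c i))) =
   (\sum_(0 <= i < n) (p i * v i + step_cst al * (p i * q i `^ al))) *
   (pr P a * lnrm P r F a).
  rewrite mulr_suml; apply: eq_bigr => i _.
  have -> : lnrm P r F (c i) = q i `^ al * lnrm P r F a.
    by rewrite /lnrm -powRM ?divr_ge0 ?lpow_ge0// /q mulfVK.
  have -> : incr a (c i) = v i * lnrm P r F a by rewrite /v mulfVK ?gt_eqF.
  have -> : pr P (c i) = p i * pr P a by rewrite /p mulfVK ?gt_eqF.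
  lra.
rewrite ler_wpM2r ?mulr_ge0 ?pr_ge0 ?lnrm_ge0//.
apply: sum_child_bound => //.
- by move=> i; rewrite divr_ge0 ?pr_ge0//= ler_pdivrMr// mul1r le_pr.
- by move=> i; rewrite divr_ge0 ?lpow_ge0//= ler_pdivrMr// mul1r le_lpow.
- move=> i; rewrite divr_ge0 ?incr_ge0 ?lnrm_ge0//= ler_pdivrMr//.
  exact: incr_le2.
- by move=> i _; rewrite ler_pdivrMr// mulrC; exact: incr_le_rest.
- by rewrite -mulr_suml ler_pdivrMr// mul1r; exact: sum_pr_le.
- rewrite -mulr_suml ler_pdivrMr// mul1r -lee_fin -sumEFin.
  under eq_bigr do rewrite lpowE//.
  rewrite lpowE//; apply: sum_integral_le => //.
  by have /integrableP[] := lpow_integrableS LF ma.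
Qed.

End OneStep.

(** * Atoms of the filtration *)

Section Atoms.
Context d (T : measurableType d) (R : realType) (P : probability T R).
Context (Fs At : nat -> set_system T).
Hypothesis afil : atomic_filtration Fs At.
Implicit Types (a : set T) (n : nat) (w : T).

Definition blk n w : set T := pblock (At n) id w.

Lemma blk_spec n w : At n (blk n w) /\ blk n w w.
Proof.
have [cov _ _] := atoms_partition afil n.
have : cover (At n) id w by rewrite cov.
by move=> [a Aa aw]; 
have := @getPex _ [set i | At n i /\ id i w]; apply; by exists a.
Qed.

Lemma blk_atom n w : At n (blk n w). Proof. by have [] := blk_spec n w. Qed.
Lemma blk_mem n w : blk n w w. Proof. by have [] := blk_spec n w. Qed.

Lemma blkE n a w : At n a -> a w -> blk n w = a.
Proof.
have [_ triv _] := atoms_partition afil n.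
move=> Aa aw; apply: (triv _ _ (blk_atom n w) Aa); exists w.
by split => //; exact: blk_mem.
Qed.

Lemma blk_eq n w w' : blk n w w' -> blk n w' = blk n w.
Proof. by move=> h; apply: blkE h; exact: blk_atom. Qed.

Lemma atom_nonempty n a : At n a -> exists w, a w.
Proof. by have [_ _ ne] := atoms_partition afil n => /ne. Qed.

Lemma atom_Fs n a : At n a -> Fs n a.
Proof. by rewrite (atoms_generate afil) => Aa; exact: sub_sigma_algebra. Qed.

Lemma atom_measurable n a : At n a -> measurable a.
Proof. by move=> /atom_Fs; exact: (filtration_measurable afil). Qed.

Lemma blk_measurable n w : measurable (blk n w).
Proof. exact: atom_measurable (blk_atom n w). Qed.

(** The sets that do not split any block form a sigma-algebra containing the atoms, hence all of
    [Fs n]. *)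
Lemma Fs_saturated n X w : Fs n X -> X w -> blk n w `<=` X.
Proof.
rewrite (atoms_generate afil).
suff : <<s At n >> `<=` [set Y | forall w w', blk n w w' -> Y w <-> Y w'].
  by move=> sat FX Xw w' /(sat _ FX) <-.
apply: smallest_sub.
- split => /=.
  + by [].
  + move=> A hA u u' uu'.
    by split => -[_ nA]; split => // /(hA _ _ uu').
  + move=> A hA u u' uu'; split => -[i _ Ai]; exists i => //; exact/(hA i _ _ uu').
- move=> a Aa u u' uu'; split => h.
    by move: uu'; rewrite (blkE Aa h).
  by rewrite -(blkE Aa h) (blk_eq uu'); exact: blk_mem.
Qed.

Lemma blk_subS n w : blk n.+1 w `<=` blk n w.
Proof.
apply: Fs_saturated; last exact: blk_mem.
exact/(filtration_nondecreasing afil)/atom_Fs/blk_atom.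
Qed.

Lemma blk_sub n m w : (n <= m)%N -> blk m w `<=` blk n w.
Proof.
move=> /subnK <-; elim: (m - n)%N => [//|k ih].
by apply: subset_trans ih; exact: blk_subS.
Qed.

Lemma blk_separates (w w' : T) : w <> w' -> exists n, ~ blk n w w'.
Proof.
move=> /(filtration_separates afil)[n [X [FX Xw nXw']]].
by exists n => /(Fs_saturated FX Xw).
Qed.

Lemma atom_enum n : exists e : nat -> set T,
  [/\ forall i, At n (e i) \/ e i = set0, trivIset setT e &
      \bigcup_i e i = setT].
Proof.
have /countable_injP[f finj] := atoms_countable afil n.
exists (fun i => [set w | f (blk n w) = i]); split.
- move=> i; have [[w wi]|h] := pselect (exists w, f (blk n w) = i); [left|right].
    suff -> : [set w0 | f (blk n w0) = i] = blk n w by exact: blk_atom.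
    apply/seteqP; split => w' /=.
      rewrite -wi => e.
      have -> : blk n w = blk n w' by apply: finj => //; rewrite ?inE; exact: blk_atom.
      exact: blk_mem.
    by move=> /blk_eq ->.
  by rewrite -subset0 => w wi; apply: h; exists w.
- by move=> i j _ _ [w [/= <- <-]].
- by rewrite -subTset => w _; exists (f (blk n w)).
Qed.

(** By nesting, an atom of level [m] that meets [a] lies inside it. The level [m] is arbitrary
    because atoms are also split across several generations at once, in the proof of convergence. *)
Lemma atom_children n m a : (n <= m)%N -> At n a -> exists c : nat -> set T,
  [/\ forall i, At m (c i) \/ c i = set0, trivIset setT c,
      (forall i, measurable (c i)), (forall i, c i `<=` a) &
      \bigcup_i c i = a].
Proof.
move=> nm Aa; have [e [eA et eT]] := atom_enum m.
have ce i : At m (a `&` e i) \/ a `&` e i = set0.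
  have [Ae|->] := eA i; last by right; rewrite setI0.
  have [->|/set0P[w [aw ew]]] := eqVneq (a `&` e i) set0; first by right.
  left; rewrite setIidr// -(blkE Ae ew) -(blkE Aa aw); exact: blk_sub.
exists (fun i => a `&` e i); split => //.
- exact: trivIset_setIl.
- by move=> i; have [/atom_measurable//|->] := ce i.
- by rewrite -setI_bigcupr eT setIT.
Qed.

(** By countability of the atoms, any union of atoms is a countable one; so every function of the
    block is measurable, whatever it is. *)
Lemma preimage_blk_Fs n (X : set (set T)) : Fs n [set w | X (blk n w)].
Proof.
have [e [eA et eT]] := atom_enum n.
have -> : [set w | X (blk n w)] =
    \bigcup_i (if `[< X (e i) >] then e i else set0).
  apply/seteqP; split => [w /= Xw|w [i _]].
    have : (\bigcup_i e i) w by rewrite eT.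
    move=> [i _ eiw]; exists i => //.
    case: (eA i) => [Ae|e0]; last by move: eiw; rewrite e0.
    by rewrite asboolT// -(blkE Ae eiw).
  case: asboolP => // Xe eiw /=.
  case: (eA i) => [Ae|e0]; last by move: eiw; rewrite e0.
  by rewrite (blkE Ae eiw).
rewrite (atoms_generate afil).
have sa : sigma_algebra setT <<s At n >> by exact: smallest_sigma_algebra.
case: sa => s0 sC sU; apply: sU => i.
case: asboolP => // _; have [Ae|->//] := eA i.
exact: sub_sigma_algebra.
Qed.

Lemma measurable_fun_blk (d' : measure_display) (U : measurableType d') n
    (phi : set T -> U) :
  measurable_fun setT (fun w => phi (blk n w)).
Proof.
move=> _ Y mY; rewrite setTI.
exact/(filtration_measurable afil)/(preimage_blk_Fs n [set a | Y (phi a)]).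
Qed.

(** The space is nonempty because it has probability 1, and a nonempty set of [Fs 0] is everything.
    This turns estimates on atoms into global ones. *)
Lemma root_atom : At 0%N setT.
Proof.
have [w _] : exists w : T, True.
  apply: contrapT => h; have := probability_setT P.
  rewrite (_ : setT = set0) ?measure0; last first.
    by rewrite -subset0 => w _; apply: h; exists w.
  by move=> /eqP; rewrite eqe eq_sym oner_eq0.
have := atom_Fs (blk_atom 0%N w); rewrite (filtration0 afil) => -[e|<-].
  by have := blk_mem 0%N w; rewrite e.
exact: blk_atom.
Qed.

End Atoms.

(** * Conditional expectations *)

Section Condexp.
Context d (T : measurableType d) (R : realType) (P : probability T R).
Implicit Types (F : T -> R) (A : set T).

Lemma integral_mean F A : P.-integrable setT (EFin \o F) -> measurable A ->
  (\int[P]_(x in A) (F x)%:E = (mean P F A * pr P A)%:E)%E.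
Proof.
move=> iF mA.
have iA : P.-integrable A (EFin \o F) by exact: integrableS iF.
have [A0|A0] := eqVneq (pr P A) 0.
  rewrite A0 mulr0 null_set_integral//; first by have /integrableP[] := iA.
  by rewrite -[RHS]/(0%:E) -A0 prE.
by rewrite /mean mulfVK// /Rintegral fineK//; exact: integrable_fin_num.
Qed.

Lemma integral_cst_on (k : R) A : measurable A ->
  (\int[P]_(x in A) k%:E = (k * pr P A)%:E)%E.
Proof. by move=> mA; rewrite integral_cst// EFinM prE. Qed.

Context (Fs At : nat -> set_system T).
Hypothesis afil : atomic_filtration Fs At.

Lemma integral_mean_blk F n a : P.-integrable setT (EFin \o F) -> At n a ->
  (\int[P]_(x in a) (mean P F (blk At n x))%:E = \int[P]_(x in a) (F x)%:E)%E.
Proof.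
move=> iF Aa; have ma := atom_measurable afil Aa.
rewrite [RHS]integral_mean// -integral_cst_on//; apply: eq_integral => x.
by rewrite inE => ax; rewrite (blkE afil Aa ax).
Qed.

Lemma is_condexp_mean F n : P.-integrable setT (EFin \o F) ->
  is_condexp P (Fs n) F (fun w => mean P F (blk At n w)).
Proof.
move=> iF; have [e [eA et eT]] := atom_enum afil n.
have me i : measurable (e i) by have [/(atom_measurable afil)|->] := eA i.
have mg : measurable_fun setT (fun w => mean P F (blk At n w)).
  exact: (@measurable_fun_blk _ _ _ _ afil _ _ n (mean P F)).
have ig : P.-integrable setT (EFin \o fun w => mean P F (blk At n w)).
  apply/integrableP; split; first exact/measurable_EFinP.
  have [mF iF'] := integrableP _ _ _ iF.
  (* On each atom [e], [|mean e| * pr e] is at most the integral of [|F|] over [e]; the atoms cover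
     the space. *)
  apply: le_lt_trans iF'; rewrite -eT !ge0_integral_bigcup ?eT//; last 2 first.
    exact: measurableT_comp.
    by apply: measurableT_comp => //; exact/measurable_EFinP.
  apply: lee_nneseries => i _; first by move=> _; exact: integral_ge0.
  have [Ae|->] := eA i; last by rewrite !integral_set0.
  rewrite (eq_integral (fun=> `|mean P F (e i)|%:E)); last first.
    by move=> x; rewrite inE => ex; rewrite /= (blkE afil Ae ex).
  rewrite integral_cst_on// -[X in _ * X](ger0_norm (pr_ge0 P _)) -normrM.
  rewrite -[leLHS]/(`|(mean P F (e i) * pr P (e i))%:E|)%E.
  rewrite -integral_mean//; apply: le_abse_integral => //.
  exact: measurable_funTS.
split => //.
- move=> _ [Y mY <-]; rewrite setTI.
  exact: (preimage_blk_Fs afil n [set a | Y (mean P F a)]).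
- move=> B FB.
  (* By saturation [B] is a union of atoms, so it is enough to compare the integrals on a single
     atom. *)
  have BE : B = \bigcup_i (B `&` e i) by rewrite -setI_bigcupr eT setIT.
  have Be i : B `&` e i = e i \/ B `&` e i = set0.
    have [Ae|->] := eA i; last by right; rewrite setI0.
    have [->|/set0P[w [Bw ew]]] := eqVneq (B `&` e i) set0; first by right.
    left; rewrite setIidr// -(blkE afil Ae ew).
    exact: (Fs_saturated afil FB Bw).
  have mB : measurable B by exact: (filtration_measurable afil) FB.
  rewrite BE !integral_bigcup -?BE //; last 6 first.
  + exact: trivIset_setIl.
  + by move=> i; exact: measurableI.
  + exact: integrableS iF.
  + exact: trivIset_setIl.
  + by move=> i; exact: measurableI.
  + exact: integrableS ig.
  apply: eq_eseriesr => i _.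
  have [->|->] := Be i; last by rewrite !integral_set0.
  have [Ae|->] := eA i; last by rewrite !integral_set0.
  exact: integral_mean_blk.
Qed.

Lemma condexpP F n : P.-integrable setT (EFin \o F) ->
  is_condexp P (Fs n) F (condexp P (Fs n) F).
Proof.
move=> iF; rewrite /condexp.
have := @xgetPex _ (cst 0%R) [set g | is_condexp P (Fs n) F g].
by apply; exists (fun w => mean P F (blk At n w)); exact: is_condexp_mean.
Qed.

(** Measurability with respect to [Fs n] makes any version constant on the block, and the integral
    over a block of positive probability fixes the constant. *)
Lemma condexpE F n w : P.-integrable setT (EFin \o F) ->
  pr P (blk At n w) != 0 -> condexp P (Fs n) F w = mean P F (blk At n w).
Proof.
move=> iF p0; have [mg ig Eg] := condexpP n iF.
set g := condexp _ _ _ in mg ig Eg *.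
have Ab := blk_atom afil n w; have mb := blk_measurable afil n w.
have gw : Fs n [set x | g x = g w].
  apply: mg; exists [set g w]; first exact: measurable_set1.
  by rewrite setTI.
have gc := Fs_saturated afil gw (erefl : [set x | g x = g w] w).
have := Eg _ (atom_Fs afil Ab); rewrite (integral_mean iF)//.
rewrite (eq_integral (fun=> (g w)%:E)); last first.
  by move=> x; rewrite inE => /gc ->.
by rewrite integral_cst_on// => -[] /(mulIf p0).
Qed.

Lemma condexp_event_condexp F n a : P.-integrable setT (EFin \o F) -> At n a ->
  pr P a != 0 -> fine (condexp_event P a (condexp P (Fs n) F)) = mean P F a.
Proof.
move=> iF Aa p0; have [mg ig Eg] := condexpP n iF.
have ma := atom_measurable afil Aa.
rewrite /condexp_event (Eg _ (atom_Fs afil Aa)) (integral_mean iF ma).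
by rewrite -(prE P ma) inver (negbTE p0) -EFinM/= mulfK.
Qed.

End Condexp.

(** * Variation below an atom *)

Section TreeSums.
Context d (T : measurableType d) (R : realType) (P : probability T R).

(** The passage from finite sums over the pieces to the integral over their countable union. *)
Lemma integral_pieces_le (f : T -> \bar R) (a : set T) (c : nat -> set T)
    (x : nat -> R) (M : R) :
  (forall i, measurable (c i)) -> trivIset setT c -> \bigcup_i c i = a ->
  measurable_fun a f -> (forall w, a w -> 0 <= f w)%E ->
  (forall i, \int[P]_(w in c i) f w <= (x i)%:E)%E ->
  (forall n, \sum_(0 <= i < n) x i <= M) ->
  (\int[P]_(w in a) f w <= M%:E)%E.
Proof.
move=> mc tc ca mf f0 fx xM.
rewrite -ca ge0_integral_bigcup ?ca//.
have f0c i : (0 <= \int[P]_(w in c i) f w)%E.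
  by apply: integral_ge0 => w cw; apply: f0; rewrite -ca; exists i.
apply: lime_le; first exact: is_cvg_nneseries.
apply: nearW => n; apply: (@le_trans _ _ (\sum_(0 <= i < n) (x i)%:E)%E).
  by apply: lee_sum => i _; exact: fx.
by rewrite sumEFin lee_fin.
Qed.

Context (r : R).
Hypothesis r_gt1 : 1 < r.
Context (Fs At : nat -> set_system T).
Hypothesis afil : atomic_filtration Fs At.
Implicit Types (F : T -> R).

Definition var_term F n w : R :=
  incr P r F (blk At n w) (blk At n.+1 w).

(** The total variation below level [n], cut off after [k] generations; all bounds on it are uniform
    in [k]. *)
Definition var_sum F n k w : R := \sum_(0 <= j < k) var_term F (n + j) w.

Lemma var_term_ge0 F n w : 0 <= var_term F n w.
Proof. exact: incr_ge0. Qed.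

Lemma var_sum_ge0 F n k w : 0 <= var_sum F n k w.
Proof. by apply: sumr_ge0 => i _; exact: var_term_ge0. Qed.

Lemma var_sumS F n k w :
  var_sum F n k.+1 w = var_term F n w + var_sum F n.+1 k w.
Proof.
rewrite /var_sum big_nat_recl// addn0; congr (_ + _).
by apply: eq_bigr => i _; rewrite addSnnS.
Qed.

Lemma measurable_var_term F n : measurable_fun setT (var_term F n).
Proof.
rewrite /var_term /incr; apply: measurable_funM.
  exact: (measurable_fun_blk afil _ (fun c => pr P c `^ r^-1)).
apply: measurableT_comp => //; apply: measurable_funB.
  exact: (measurable_fun_blk afil _ (mean P F)).
exact: (measurable_fun_blk afil _ (mean P F)).
Qed.

Lemma measurable_var_sum F n k : measurable_fun setT (var_sum F n k).
Proof. by apply: measurable_sum => j; exact: measurable_var_term. Qed.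

Let C := step_cst r^-1.
(** With [C = step_cst r^-1], this choice [K = (2 + 2C) C] makes [p v^2 + 2 v C p L + K p L^2] at
    most [(2 + 2C) phi (p v + C p L)] whenever [v <= 2 phi] and [L <= phi], so that [one_step]
    bounds the second moment as well. *)
Definition var_cst : R := (2 + 2 * step_cst r^-1) * step_cst r^-1.
Let K := var_cst.

Let C_gt0 : 0 < C.
Proof. by apply: step_cst_gt0; rewrite ?invr_gt0 ?invf_lt1// (lt_trans _ r_gt1). Qed.

Lemma var_cst_gt0 : 0 < var_cst.
Proof. by have C0 := C_gt0; rewrite mulr_gt0//; rewrite -/C; lra. Qed.

(* Both moments are controlled together: the square telescopes because the
   increment is constant on each child, which turns the first moment of the
   remaining sum into the bound for the cross term. *)
Lemma var_sum_bound F k n a : Lr P r F -> At n a ->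
  (\int[P]_(w in a) (var_sum F n k w)%:E <=
     (C * (pr P a * lnrm P r F a))%:E /\
   \int[P]_(w in a) (var_sum F n k w ^+ 2)%:E <=
     (K * (pr P a * lnrm P r F a ^+ 2))%:E)%E.
Proof.
move=> LF; have C0 := C_gt0; have K0 := var_cst_gt0.
have mS m j A : measurable_fun A (EFin \o var_sum F m j).
  by apply/measurable_EFinP; apply: measurable_funTS; exact: measurable_var_sum.
have mS2 m j A : measurable_fun A (EFin \o (fun w => var_sum F m j w ^+ 2)).
  apply/measurable_EFinP; apply: measurable_funTS; apply: measurable_funX.
  exact: measurable_var_sum.
elim: k n a => [|k ih] n a Aa.
  have S0 w : var_sum F n 0 w = 0 by rewrite /var_sum big_nil.
  have pL := mulr_ge0 (pr_ge0 P a) (lnrm_ge0 P r F a).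
  have pL2 := mulr_ge0 (pr_ge0 P a) (exprn_ge0 2 (lnrm_ge0 P r F a)).
  split.
    rewrite (eq_integral (cst 0%E)); last by move=> w _; rewrite S0.
    by rewrite integral0 lee_fin (mulr_ge0 (ltW C0)).
  rewrite (eq_integral (cst 0%E)); last by move=> w _; rewrite S0 expr0n.
  by rewrite integral0 lee_fin (mulr_ge0 (ltW K0)).
have ma := atom_measurable afil Aa.
(* [one_step] needs an atom of positive probability; on a null atom both integrals are 0. *)
have [pa0|pa0] := eqVneq (pr P a) 0.
  have Pa0 : P a = 0%E by rewrite -prE// pa0.
  rewrite pa0 !mul0r !mulr0; split; rewrite null_set_integral//.
    exact: mS.
  exact: mS2.
have pa : 0 < pr P a by rewrite lt_neqAle eq_sym pa0 pr_ge0.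
have [c [cA tc mc ca cT]] := atom_children afil (leqnSn n) Aa.
set v := fun i => incr P r F a (c i).
set p := fun i => pr P (c i).
set L := fun i => lnrm P r F (c i).
have p0 i : 0 <= p i by exact: pr_ge0.
have L0 i : 0 <= L i by exact: lnrm_ge0.
have v0 i : 0 <= v i by exact: incr_ge0.
have La i : L i <= lnrm P r F a by exact: le_lnrm.
have va i : v i <= 2 * lnrm P r F a by exact: incr_le2.
have vE i w : c i w -> var_term F n w = v i.
  move=> cw; have aw := ca _ _ cw; have [Ac|c0] := cA i; last by rewrite c0 in cw.
  by rewrite /var_term (blkE afil Aa aw) (blkE afil Ac cw).
have S0 := var_sum_ge0 F.
have bounds i :
  (\int[P]_(w in c i) (var_sum F n.+1 k w)%:E <= (C * (p i * L i))%:E /\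
   \int[P]_(w in c i) (var_sum F n.+1 k w ^+ 2)%:E <=
     (K * (p i * L i ^+ 2))%:E)%E.
  have [/ih//|c0] := cA i.
  rewrite c0 !integral_set0 !lee_fin.
  have pL := mulr_ge0 (p0 i) (L0 i).
  have pL2 := mulr_ge0 (p0 i) (exprn_ge0 2 (L0 i)).
  by rewrite (mulr_ge0 (ltW C0))// (mulr_ge0 (ltW K0)).
have sums N := one_step r_gt1 LF N ma mc tc ca pa.
have int1 i : (\int[P]_(w in c i) (var_sum F n k.+1 w)%:E =
    (p i * v i)%:E + \int[P]_(w in c i) (var_sum F n.+1 k w)%:E)%E.
  rewrite mulrC -integral_cst_on// -ge0_integralD//; last 2 first.
    by move=> w _; rewrite lee_fin.
    exact: mS.
  - by apply: eq_integral => w; rewrite inE => cw; rewrite var_sumS (vE i).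
  - by move=> w _; rewrite lee_fin.
have int2 i : (\int[P]_(w in c i) (var_sum F n k.+1 w ^+ 2)%:E =
    (p i * v i ^+ 2)%:E + (2 * v i)%:E * \int[P]_(w in c i) (var_sum F n.+1 k w)%:E
    + \int[P]_(w in c i) (var_sum F n.+1 k w ^+ 2)%:E)%E.
  rewrite mulrC -integral_cst_on// -ge0_integralZl//; last 3 first.
    exact: mS.
    by move=> w _; rewrite lee_fin.
    by rewrite lee_fin mulr_ge0.
  have v20 : 0 <= 2 * v i by rewrite mulr_ge0.
  rewrite -ge0_integralD//; last 3 first.
    by move=> w _; rewrite lee_fin sqr_ge0.
    by move=> w _; rewrite lee_fin mulr_ge0.
    by apply: measurable_funeM; exact: mS.
  rewrite -ge0_integralD//; last 4 first.
    by move=> w _; rewrite lee_fin addr_ge0 ?sqr_ge0// mulr_ge0.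
    by apply: emeasurable_funD => //; apply: measurable_funeM; exact: mS.
    by move=> w _; rewrite lee_fin sqr_ge0.
    exact: mS2.
  apply: eq_integral => w; rewrite inE => cw; rewrite var_sumS (vE i)//.
  by rewrite -EFinM -!EFinD sqrrD mulr2n mulrDl mul1r mulrDl.
split.
  apply: (integral_pieces_le mc tc cT) (mS _ _ _) _ _ sums.
    by move=> w _; rewrite lee_fin.
  by move=> i; rewrite int1 EFinD leeD2l//; have [] := bounds i.
(* [one_step] multiplied by [(2 + 2 * C) * lnrm a]. *)
have sums' N : \sum_(0 <= i < N) (2 + 2 * C) * lnrm P r F a *
    (p i * v i + C * (p i * L i)) <= K * (pr P a * lnrm P r F a ^+ 2).
  rewrite -mulr_sumr /K /var_cst -/C.
  have -> : (2 + 2 * C) * C * (pr P a * lnrm P r F a ^+ 2) =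
    (2 + 2 * C) * lnrm P r F a * (C * (pr P a * lnrm P r F a)) by lra.
  by rewrite ler_wpM2l ?sums// mulr_ge0 ?lnrm_ge0//; lra.
apply: (integral_pieces_le mc tc cT) (mS2 _ _ _) _ _ sums'.
  by move=> w _; rewrite lee_fin sqr_ge0.
move=> i; rewrite int2; have [b1 b2] := bounds i.
apply: (@le_trans _ _ ((p i * v i ^+ 2)%:E +
    (2 * v i)%:E * (C * (p i * L i))%:E + (K * (p i * L i ^+ 2))%:E)%E).
  apply: leeD => //; apply: leeD => //.
  by apply: lee_wpmul2l => //; rewrite lee_fin mulr_ge0.
rewrite -EFinM -!EFinD lee_fin /K /var_cst -/C.
have pv0 : 0 <= p i * v i by rewrite mulr_ge0.
have pL0 : 0 <= p i * L i by rewrite mulr_ge0.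
have h1 : p i * v i * v i <= p i * v i * (2 * lnrm P r F a).
  exact: (ler_wpM2l pv0 (va i)).
have h2 : C * (p i * v i) * L i <= C * (p i * v i) * lnrm P r F a.
  exact: (ler_wpM2l (mulr_ge0 (ltW C0) pv0) (La i)).
have h3 : ((2 + 2 * C) * C) * (p i * L i) * L i <=
    ((2 + 2 * C) * C) * (p i * L i) * lnrm P r F a.
  exact: (ler_wpM2l (mulr_ge0 (ltW K0) pL0) (La i)).
by rewrite !expr2; lra.
Qed.

End TreeSums.

(** * Uniform smallness of the tails *)

Section Translation.
Context d (T : measurableType d) (R : realType) (P : probability T R).
Context (r : R).
Hypothesis r_gt1 : 1 < r.
Implicit Types (F : T -> R).

Let r_gt0 : 0 < r. Proof. exact: lt_trans r_gt1. Qed.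

Lemma powR_normB_le (x y : R) :
  `|x - y| `^ r <= 2 `^ r * (`|x| `^ r + `|y| `^ r).
Proof.
rewrite mulrDr -!powRM//.
have h (u v : R) : `|u| <= `|v| -> `|u - v| `^ r <= (2 * `|v|) `^ r.
  move=> uv; rewrite ge0_ler_powR ?nnegrE ?mulr_ge0 ?(ltW r_gt0)//.
  by rewrite (le_trans (ler_normB _ _))//; lra.
have [xy|xy] := leP `|x| `|y|.
  by rewrite (le_trans (h _ _ xy))// lerDr powR_ge0.
by rewrite distrC (le_trans (h _ _ (ltW xy)))// lerDl powR_ge0.
Qed.

Lemma Lr_subc F c : Lr P r F -> Lr P r (fun w => F w - c).
Proof.
move=> [mF iF].
have mFc : measurable_fun setT (fun w => F w - c).
  exact: measurable_funB.
split => //.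
apply: (@le_integrable _ _ _ _ _ measurableT _
  (fun x => (2 `^ r)%:E * ((`|F x| `^ r)%:E + (`|c| `^ r)%:E))%E) => //.
- apply/measurable_EFinP.
  apply: (measurableT_comp (measurable_powR r)).
  exact: measurableT_comp.
- move=> x _ /=; rewrite lee_fin (ger0_norm (powR_ge0 _ _)).
  exact: le_trans (powR_normB_le _ _) (ler_norm _).
- apply: integrableZl => //; apply: integrableD => //.
  exact: (finite_measure_integrable_cst P).
Qed.

Lemma mean_subc F c A : Lr P r F -> measurable A -> pr P A != 0 ->
  mean P (fun w => F w - c) A = mean P F A - c.
Proof.
move=> LF mA A0; rewrite /mean RintegralB//.
- by rewrite mulrBl Rintegral_cst// mulfK.
- exact: Lr_integrableS LF mA.
- exact: (finite_measure_integrable_cst P).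
Qed.

Context (Fs At : nat -> set_system T).
Hypothesis afil : atomic_filtration Fs At.

Lemma var_term_subc F c n w : Lr P r F ->
  var_term P r At (fun w => F w - c) n w = var_term P r At F n w.
Proof.
move=> LF; rewrite /var_term /incr.
have mb m := blk_measurable afil m w.
(* The mean over a null block is 0 by division by zero and does not shift with [c], but there the
   prefactor vanishes. *)
have [->|p0] := eqVneq (pr P (blk At n.+1 w)) 0.
  by rewrite powR0 ?mul0r// invr_eq0 gt_eqF.
have p0' : pr P (blk At n w) != 0.
  rewrite gt_eqF// (lt_le_trans _ (le_pr P (mb n.+1) (mb n) _))//.
    by rewrite lt_neqAle eq_sym p0 pr_ge0.
  exact: (blk_subS afil).
by rewrite !mean_subc//; congr (_ * `|_|); lra.
Qed.

Lemma var_sum_oscillation F n k a c : Lr P r F -> At n a ->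
  (\int[P]_(w in a) (var_sum P r At F n k w ^+ 2)%:E <=
   (var_cst r * (pr P a * lnrm P r (fun w => F w - c) a ^+ 2))%:E)%E.
Proof.
move=> LF Aa.
have [_] := var_sum_bound r_gt1 afil k (Lr_subc c LF) Aa.
rewrite (eq_integral (fun w => (var_sum P r At F n k w ^+ 2)%:E))// => w _.
congr (_ ^+ 2)%:E; apply: eq_bigr => j _; exact: (var_term_subc c _ _ LF).
Qed.

(** Dominated convergence with [f] itself as the bound. The alternative [f x = 0] allows a point
    lying in every [A n], as [w] does in its own blocks when [f = |F - F w|^r]. *)
Lemma integral_vanish (f : T -> R) (A : nat -> set T) (e : R) :
  P.-integrable setT (EFin \o f) -> (forall x, 0 <= f x) ->
  (forall n, measurable (A n)) ->
  (forall x, f x = 0 \/ \forall n \near \oo, ~ A n x) -> 0 < e ->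
  \forall n \near \oo, \int[P]_(x in A n) f x < e.
Proof.
move=> iF f0 mA fA e0.
have mf : measurable_fun setT f by have /integrableP[/measurable_EFinP] := iF.
have := @dominated_cvg _ _ _ P setT measurableT
  (fun n => EFin \o (f \_ (A n))) (cst 0%E) (EFin \o f).
move=> /(_ _ _ _ iF) h.
have {}h : (\int[P]_x (EFin \o (f \_ (A n))) x @[n --> \oo] --> 0)%E.
  have := h _ _ _ _; rewrite integral0; apply.
  - move=> n; apply/measurable_EFinP.
    exact/(measurable_restrictT _ (mA n)).1/measurable_funTS.
  - move=> x _; apply: cvg_near_cst.
    have [fx0|nA] := fA x.
      by apply: nearW => n /=; rewrite /patch fx0 if_same.
    by apply: filterS nA => n nAn; rewrite /= /patch memNset.
  - by [].
  - move=> n x _ /=; rewrite lee_fin /patch; case: ifPn => _.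
      by rewrite ger0_norm.
    by rewrite normr0.
have /fine_cvgP[_ /cvgr0Pnorm_lt /(_ _ e0)] := h.
apply: filterS => n; rewrite /= /Rintegral integral_mkcond.
rewrite (eq_integral (fun x => ((f \_ (A n)) x)%:E)); last first.
  by move=> x _; rewrite /patch; case: ifPn.
by apply: le_lt_trans; exact: ler_norm.
Qed.

Lemma lpow_small F (e : R) : Lr P r F -> 0 < e ->
  \forall n \near \oo, forall a, At n a ->
    exists c, lpow P r (fun w => F w - c) a < e.
Proof.
move=> LF e0.
pose good b := exists c, lpow P r (fun w => F w - c) b < e.
pose bad n := [set w | ~ good (blk At n w)].
have mbad n : measurable (bad n).
  exact/(filtration_measurable afil)/(preimage_blk_Fs afil n [set b | ~ good b]).
(* The blocks of [w] shrink to the point [w], where [|F - F w|^r] vanishes; hence [c = F w]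
   eventually works. *)
have bad_vanish w : \forall n \near \oo, ~ bad n w.
  have [_ iFw] := Lr_subc (F w) LF.
  have : \forall n \near \oo,
      \int[P]_(x in blk At n w) (`|F x - F w| `^ r) < e.
    apply: integral_vanish => //.
    - by move=> n; exact: (blk_measurable afil).
    - move=> x; have [->|xw] := pselect (x = w).
        by left; rewrite subrr normr0 powR0// gt_eqF.
      right; have [n nb] := blk_separates afil (nesym xw).
      by exists n => // m /= nm /(blk_sub afil nm).
  by apply: filterS => n hn /= ; apply; exists (F w).
have [_ iF] := LF.
have : \forall n \near \oo, \int[P]_(x in bad n) (`|F x| `^ r) < e.
  apply: integral_vanish => //.
  by move=> x; right; exact: bad_vanish.
apply: filterS => n small a Aa; apply: contrapT => nga.
have [w aw] := atom_nonempty afil Aa.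
have asub : a `<=` bad n.
  by move=> w' aw'; rewrite /bad /= (blkE afil Aa aw').
(* A bad atom lies inside [bad n], where [|F|^r] already has integral less than [e]; so [c = 0]
   would make it good. *)
apply: nga; exists 0; apply: le_lt_trans small.
rewrite (_ : (fun w => F w - 0) = F); last by apply/funext => x; rewrite subr0.
apply: le_lpow => //; exact: (atom_measurable afil Aa).
Qed.

Lemma var_sum_small F (e : R) : Lr P r F -> 0 < e ->
  \forall n \near \oo, forall k a, At n a ->
    (\int[P]_(w in a) (var_sum P r At F n k w ^+ 2)%:E <= (e * pr P a)%:E)%E.
Proof.
move=> LF e0; have K0 := var_cst_gt0 r_gt1.
pose s := e / var_cst r.
have s0 : 0 < s by rewrite divr_gt0.
(* With this threshold for the [r]-th power, the local norm is at most [sqrt s], and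
   [var_cst r * s = e]. *)
have t0 : 0 < Num.sqrt s `^ r by rewrite powR_gt0// sqrtr_gt0.
apply: filterS (lpow_small LF t0) => n small k a Aa.
have [c ce] := small a Aa.
apply: le_trans (var_sum_oscillation k c LF Aa) _.
rewrite lee_fin [leLHS]mulrCA [leRHS]mulrC ler_wpM2l ?pr_ge0//.
have -> : e = var_cst r * s by rewrite mulrC mulfVK// gt_eqF.
rewrite ler_pM2l// -[leRHS](sqr_sqrtr (ltW s0)).
rewrite ler_sqr ?nnegrE ?sqrtr_ge0 ?lnrm_ge0//.
rewrite -[leRHS](@powRr1 R) ?sqrtr_ge0// -(mulfV (lt0r_neq0 r_gt0)).
rewrite powRrM ge0_ler_powR ?nnegrE ?lpow_ge0 ?powR_ge0 ?invr_ge0 ?(ltW r_gt0)//.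
exact: ltW.
Qed.

End Translation.

(** * The BMO seminorm *)

Section BMO.
Context d (T : measurableType d) (R : realType) (P : probability T R).
Implicit Types (h : T -> R) (A : set T).

Lemma sqr_integrable h A : measurable A -> measurable_fun A h ->
  (\int[P]_(w in A) (h w ^+ 2)%:E < +oo)%E -> P.-integrable A (EFin \o h).
Proof.
move=> mA mh h2.
have mh2 : measurable_fun A (fun w => h w ^+ 2) by exact: measurable_funX.
have ih2 : P.-integrable A (EFin \o (fun w => h w ^+ 2)).
  apply/integrableP; split; first exact/measurable_EFinP.
  rewrite (eq_integral (fun w => (h w ^+ 2)%:E))// => w _ /=.
  by rewrite ger0_norm ?sqr_ge0.
apply: (@le_integrable _ _ _ _ _ mA _ (fun w => 1 + (h w ^+ 2)%:E)%E).
- exact/measurable_EFinP.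
- move=> w _ /=; rewrite lee_fin (@ger0_norm _ (1 + _)) ?addr_ge0 ?sqr_ge0//.
  rewrite -[h w ^+ 2]real_normK ?num_real//.
  have := sqr_ge0 (`|h w| - 1); have := normr_ge0 (h w).
  by rewrite !expr2; move: `|h w| => x; nra.
- apply: integrableD => //; exact: (finite_measure_integrable_cst P).
Qed.

(** With [g = h - m] and [del = mean h - m], [(h - mean h)^2 = g^2 - l] where [l = 2 del g - del^2]
    has integral [del^2 * pr A >= 0]. Thus any constant may replace the mean when BMO norms are
    bounded from above. *)
Lemma variance_min h A m : P.-integrable A (EFin \o h) -> measurable A ->
  pr P A != 0 ->
  (\int[P]_(w in A) ((h w - mean P h A) ^+ 2)%:E <=
   \int[P]_(w in A) ((h w - m) ^+ 2)%:E)%E.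
Proof.
move=> ih mA A0.
have mh : measurable_fun A h by have /integrableP[/measurable_EFinP] := ih.
set I := (\int[P]_(w in A) ((h w - m) ^+ 2)%:E)%E.
have [Ioo|Ioo] := eqVneq I +oo%E; first by rewrite Ioo leey.
pose g w := h w - m; pose del := mean P h A - m.
have mg2 : measurable_fun A (fun w => g w ^+ 2).
  by apply: measurable_funX; exact: measurable_funB.
have ig2 : P.-integrable A (EFin \o (fun w => g w ^+ 2)).
  apply/integrableP; split; first exact/measurable_EFinP.
  rewrite (eq_integral (fun w => (g w ^+ 2)%:E)); first by rewrite ltey.
  by move=> w _ /=; rewrite ger0_norm ?sqr_ge0.
have icst k : P.-integrable A (EFin \o cst k).
  exact: (finite_measure_integrable_cst P).
have ig : P.-integrable A (EFin \o g).
  by have := integrableB mA ih (icst m); exact: eq_integrable.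
pose l w := 2 * del * g w - del ^+ 2.
have idg : P.-integrable A (EFin \o (fun w => 2 * del * g w)).
  by have := integrableZl mA (2 * del) ig; exact: eq_integrable.
have il : P.-integrable A (EFin \o l).
  by have := integrableB mA idg (icst (del ^+ 2)); exact: eq_integrable.
have intg : \int[P]_(w in A) g w = del * pr P A.
  rewrite /g RintegralB//; last exact: icst.
  rewrite Rintegral_cst// mulrBl; congr (_ - _).
  by rewrite /mean mulfVK.
rewrite (eq_integral (fun w => (g w ^+ 2)%:E - (l w)%:E)%E); last first.
  move=> w _; rewrite -EFinB; congr EFin; rewrite /l /g /del.
  by rewrite !expr2; lra.
rewrite integralB_EFin// -[leRHS]sube0 leeB//.
have -> : (\int[P]_(w in A) (l w)%:E = (\int[P]_(w in A) l w)%:E)%E.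
  by rewrite /Rintegral fineK//; exact: integrable_fin_num.
have -> : \int[P]_(w in A) l w = 2 * del * (del * pr P A) - del ^+ 2 * pr P A.
  rewrite /l (RintegralB mA idg (icst (del ^+ 2))).
  by rewrite (RintegralZl _ mA ig) intg (Rintegral_cst P mA).
rewrite lee_fin.
by have := mulr_ge0 (sqr_ge0 del) (pr_ge0 P A); rewrite /pr !expr2; lra.
Qed.

Context (Fs At : nat -> set_system T).
Hypothesis afil : atomic_filtration Fs At.

Lemma sqrte_condexp_event_le (X : \bar R) A (K : R) : measurable A ->
  (0 <= X)%E -> 0 < pr P A -> 0 <= K ->
  (sqrte (X / P A) <= K%:E)%E = (X <= (K ^+ 2 * pr P A)%:E)%E.
Proof.
move=> mA X0 A0 K0.
have XA0 : (0 <= X / P A)%E by rewrite mule_ge0// inve_ge0 measure_ge0.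
rewrite -{1}(ger0_norm K0) -[(`|K|%:E)]/(`|K%:E|%E) -sqrte_sqr lee_sqrt ?sqre_ge0//.
by rewrite -prE// inver gt_eqF// lee_pdivrMr// EFinM EFin_expe.
Qed.

(** The slack [e] lets [m] depend on the accuracy, as happens when [h] is known only through BMO
    approximations. *)
Lemma bmo_norm_le h (K : R) : 0 <= K -> P.-integrable setT (EFin \o h) ->
  (forall n a (e : R), At n a -> 0 < pr P a -> 0 < e -> exists m,
    (\int[P]_(w in a) ((h w - m) ^+ 2)%:E <= ((K ^+ 2 + e) * pr P a)%:E)%E) ->
  (bmo_norm P Fs At h <= K%:E)%E.
Proof.
move=> K0 ih hK; apply: ge_ereal_sup => _ [n _ <-].
apply: ge_ereal_sup => _ [a [Aa Pa0] <-].
have ma := atom_measurable afil Aa.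
have pa0 : 0 < pr P a by rewrite -lte_fin prE.
rewrite /condexp_event sqrte_condexp_event_le//; last first.
  by apply: integral_ge0 => w _; rewrite lee_fin sqr_ge0.
rewrite (condexp_event_condexp afil ih Aa) ?gt_eqF//.
have iha : P.-integrable a (EFin \o h) by exact: integrableS ih.
apply/lee_addgt0Pr => e e0.
have e'0 : 0 < e / pr P a by rewrite divr_gt0.
have [m hm] := hK n a _ Aa pa0 e'0.
apply: le_trans (variance_min m iha ma _) _; first by rewrite gt_eqF.
by apply: le_trans hm _; rewrite mulrDl mulfVK ?gt_eqF.
Qed.

Lemma bmo_norm_oscillation h (K : R) n a : 0 <= K ->
  P.-integrable setT (EFin \o h) -> (bmo_norm P Fs At h <= K%:E)%E ->
  At n a -> 0 < pr P a -> exists m,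
  (\int[P]_(w in a) ((h w - m) ^+ 2)%:E <= (K ^+ 2 * pr P a)%:E)%E.
Proof.
move=> K0 ih hK Aa pa0; have ma := atom_measurable afil Aa.
exists (mean P h a).
rewrite -sqrte_condexp_event_le//; last first.
  by apply: integral_ge0 => w _; rewrite lee_fin sqr_ge0.
apply: le_trans hK.
apply: (@le_trans _ _ (ereal_sup [set sqrte (condexp_event P a (fun w =>
    (h w - fine (condexp_event P a (condexp P (Fs n) h))) ^+ 2))
    | a in [set a | At n a /\ (0 < P a)%E]])).
  apply: ereal_sup_ubound; exists a.
    by split => //; rewrite -prE// lte_fin.
  by rewrite (condexp_event_condexp afil ih Aa) ?gt_eqF.
by apply: ereal_sup_ubound; exists n.
Qed.

(** A supremum over no atoms would be [-oo]; the root atom, of probability 1, always contributes a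
    nonnegative term. *)
Lemma bmo_norm_ge0 h : (0 <= bmo_norm P Fs At h)%E.
Proof.
apply: (@le_trans _ _ (ereal_sup [set sqrte (condexp_event P a (fun w =>
    (h w - fine (condexp_event P a (condexp P (Fs 0%N) h))) ^+ 2))
    | a in [set a | At 0%N a /\ (0 < P a)%E]])).
  apply: (le_trans (sqrte_ge0 _)); apply: ereal_sup_ubound; exists setT => //.
  by split; [exact: (root_atom P afil)|rewrite /= probability_setT lte_fin].
by apply: ereal_sup_ubound; exists 0%N.
Qed.

End BMO.

(** * The Riesz potential *)

Section Riesz.
Context d (T : measurableType d) (R : realType) (P : probability T R).
Context (r : R).
Hypothesis r_gt1 : 1 < r.
Context (Fs At : nat -> set_system T).
Hypothesis afil : atomic_filtration Fs At.
Variable F : T -> R.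
Hypothesis LF : Lr P r F.

Let r_gt0 : 0 < r. Proof. exact: lt_trans r_gt1. Qed.

Local Notation u := (riesz_partial P r^-1 Fs At F).
Local Notation vs := (var_sum P r At F).
Local Notation K := (var_cst r).

(** Numbered from 0, so this is term [n+1] of the series, with block averages in place of the chosen
    versions of the conditional expectations. *)
Definition riesz_term n w : R := pr P (blk At n.+1 w) `^ r^-1 *
  (mean P F (blk At n.+1 w) - mean P F (blk At n w)).

Lemma norm_riesz_term n w : `|riesz_term n w| = var_term P r At F n w.
Proof. by rewrite /riesz_term normrM ger0_norm ?powR_ge0. Qed.

(* On null atoms the versions chosen by [condexp] are arbitrary, but there the
   factor [atom_prob ^ (1/r)] is 0. *)
Lemma riesz_partialE N w : u N w = \sum_(0 <= j < N) riesz_term j w.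
Proof.
have iF := Lr_integrable r_gt1 LF.
rewrite /riesz_partial fct_sumE big_add1 /=; apply: eq_bigr => j _.
rewrite /Mop /atom_prob /riesz_term -/(blk At j.+1 w) -/(pr P (blk At j.+1 w)).
have mb m := blk_measurable afil m w.
have [->|p0] := eqVneq (pr P (blk At j.+1 w)) 0.
  by rewrite powR0 ?mul0r// invr_eq0 gt_eqF.
have p0' : pr P (blk At j w) != 0.
  rewrite gt_eqF// (lt_le_trans _ (le_pr P (mb j.+1) (mb j) _))//.
    by rewrite lt_neqAle eq_sym p0 pr_ge0.
  exact: (blk_subS afil).
by rewrite /= !(condexpE afil iF).
Qed.

Lemma measurable_riesz_partial N : measurable_fun setT (u N).
Proof.
apply: (eq_measurable_fun (fun w => \sum_(0 <= j < N) riesz_term j w)).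
  by move=> w _; rewrite riesz_partialE.
apply: measurable_sum => j; apply: measurable_funM.
  exact: (measurable_fun_blk afil _ (fun c => pr P c `^ r^-1)).
apply: measurable_funB.
  exact: (measurable_fun_blk afil _ (mean P F)).
exact: (measurable_fun_blk afil _ (mean P F)).
Qed.

Lemma riesz_partial_dist n k w : `|u (n + k) w - u n w| <= vs n k w.
Proof.
rewrite !riesz_partialE (big_cat_nat (leq0n n) (leq_addr k n))/= addrAC subrr add0r.
rewrite -[X in index_iota X _](add0n n) big_addn addKn (le_trans (ler_norm_sum _ _ _))//.
by apply: ler_sum => j _; rewrite norm_riesz_term addnC.
Qed.

(** [u N] depends only on the blocks down to level [N]. Hence [u n] may serve as the constant in
    oscillation estimates on atoms of level [n]. *)
Lemma riesz_partial_cst n N a w w' : (N <= n)%N -> At n a -> a w -> a w' ->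
  u N w = u N w'.
Proof.
move=> Nn Aa aw aw'; rewrite !riesz_partialE.
have e m : (m <= n)%N -> blk At m w = blk At m w'.
  move=> mn; apply: esym; apply: (blk_eq afil); apply: (blk_sub afil mn).
  by rewrite (blkE afil Aa aw).
rewrite big_nat [RHS]big_nat; apply: eq_bigr => j /andP[_ jN].
have jn := leq_trans jN Nn.
by rewrite /riesz_term (e _ jn) (e _ (ltnW jn)).
Qed.

(* Where the series diverges this is a junk value; [riesz_potential_dist] holds
   there too, its right-hand side being [+oo]. *)
Definition riesz_potential w : R := fine (limn_esup (fun N => (u N w)%:E)).
Local Notation G := riesz_potential.

Lemma measurable_riesz_potential : measurable_fun setT G.
Proof.
apply: measurableT_comp => //.
apply: measurable_fun_limn_esup => N; apply/measurable_EFinP.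
exact: measurable_riesz_partial.
Qed.

Lemma nondecreasing_var_sum n w :
  {homo (fun k => vs n k w) : k l / (k <= l)%N >-> k <= l}.
Proof.
move=> k l kl; rewrite /var_sum (big_cat_nat (leq0n k) kl)/= lerDl.
by apply: sumr_ge0 => j _; exact: var_term_ge0.
Qed.

(** If the limit is a finite [M], the series converges absolutely at [w], every later partial sum is
    within [sqrt M] of [u n w], and the bound passes to the limit. *)
Lemma riesz_potential_dist n w :
  (((G w - u n w) ^+ 2)%:E <= limn (fun k => (vs n k w ^+ 2)%:E))%E.
Proof.
have nd : {homo (fun k => (vs n k w ^+ 2)%:E) : k l / (k <= l)%N >-> (k <= l)%E}.
  move=> k l kl; rewrite lee_fin ler_sqr ?nnegrE ?var_sum_ge0//.
  exact: nondecreasing_var_sum.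
have := ereal_nondecreasing_is_cvgn nd => cv.
have sup k : ((vs n k w ^+ 2)%:E <= limn (fun k => (vs n k w ^+ 2)%:E))%E.
  rewrite (cvg_lim _ (ereal_nondecreasing_cvgn nd))//.
  by apply: ereal_sup_ubound; exists k.
move: sup; set H := limn _; case: H => [M|_|sup]; last 2 first.
- exact: leey.
- by have := sup 0%N; rewrite leeNy_eq.
move=> sup.
have M0 : 0 <= M by have := sup 0%N; rewrite lee_fin; exact: le_trans (sqr_ge0 _).
have vsM k : vs n k w <= Num.sqrt M.
  by rewrite -(ger0_norm (var_sum_ge0 P r At F n k w)) -sqrtr_sqr ler_wsqrtr// -lee_fin.
have cu : cvgn (fun N => u N w).
  have -> : (fun N => u N w) = series (fun j => riesz_term j w).
    by apply/funext => N; rewrite riesz_partialE /series.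
  apply: normed_cvg.
  apply: nondecreasing_is_cvgn.
    by apply: nondecreasing_series => j _ _; exact: normr_ge0.
  (* The first [n] terms contribute [vs 0 n w], all the later ones at most [sqrt M]. *)
  exists (vs 0 n w + Num.sqrt M) => _ [N _ <-].
  have -> : [normed series (riesz_term^~ w)] N = vs 0 N w.
    by apply: eq_bigr => j _; exact: norm_riesz_term.
  apply: (@le_trans _ _ (vs 0 (n + N) w)).
    by apply: nondecreasing_var_sum; exact: leq_addl.
  rewrite {1}/var_sum (big_cat_nat (leq0n n) (leq_addr N n))/= lerD2l.
  rewrite -[X in index_iota X _](add0n n) big_addn addKn (le_trans _ (vsM N))//.
  by apply: ler_sum => j _; rewrite add0n addnC.
have uM N : (n <= N)%N -> `|u N w - u n w| <= Num.sqrt M.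
  by move=> /subnKC <-; exact: le_trans (riesz_partial_dist n _ w) (vsM _).
have GE : G w = limn (fun N => u N w).
  rewrite /riesz_potential limn_esup_lim.
  have cE : (fun N => (u N w)%:E) @ \oo --> (limn (fun N => u N w))%:E.
    by apply: cvg_EFin => //; exact: nearW.
  by rewrite (cvg_lim _ (cvg_esups cE)).
have GM : `|G w - u n w| <= Num.sqrt M.
  rewrite GE ler_norml; apply/andP; split.
    rewrite lerBrDl; apply: limr_ge => //; exists n => // N /= /uM.
    by rewrite ler_norml => /andP[h _]; rewrite -lerBrDl.
  rewrite lerBlDl; apply: limr_le => //; exists n => // N /= /uM.
  by rewrite ler_norml => /andP[_ h]; rewrite -lerBlDl.
rewrite lee_fin -(sqr_sqrtr M0) -[leLHS]real_normK ?num_real//.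
by rewrite ler_sqr ?nnegrE ?sqrtr_ge0.
Qed.

(** Monotone convergence in [k] transfers bounds on the truncated variation to [G - u n]. *)
Lemma riesz_potential_var n a (B : \bar R) : At n a ->
  (forall k, \int[P]_(w in a) (vs n k w ^+ 2)%:E <= B)%E ->
  (\int[P]_(w in a) ((G w - u n w) ^+ 2)%:E <= B)%E.
Proof.
move=> Aa hB; have ma := atom_measurable afil Aa.
have mv k : measurable_fun a (fun w => (vs n k w ^+ 2)%:E).
  apply/measurable_EFinP/measurable_funX/measurable_funTS.
  exact: (measurable_var_sum _ _ afil).
have nd w : {homo (fun k => (vs n k w ^+ 2)%:E) : k l / (k <= l)%N >-> (k <= l)%E}.
  move=> k l kl; rewrite lee_fin ler_sqr ?nnegrE ?var_sum_ge0//.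
  exact: nondecreasing_var_sum.
have mono := @monotone_convergence _ _ _ P a ma (fun k w => (vs n k w ^+ 2)%:E) mv
  (fun k w _ => sqr_ge0 (vs n k w)) (fun w _ => nd w).
apply: (@le_trans _ _ (\int[P]_(w in a) limn (fun k => (vs n k w ^+ 2)%:E))%E).
  apply: ge0_le_integral => //.
  - by move=> w _; rewrite lee_fin sqr_ge0.
  - apply/measurable_EFinP/measurable_funX/measurable_funB; apply: measurable_funTS.
      exact: measurable_riesz_potential.
    exact: measurable_riesz_partial.
  - apply: (emeasurable_fun_cvg (fun k w => (vs n k w ^+ 2)%:E)) => // w _.
    exact: ereal_nondecreasing_is_cvgn.
  - by move=> w _; exact: riesz_potential_dist.
rewrite mono; apply: lime_le; last exact: nearW.
apply: ereal_nondecreasing_is_cvgn => k l kl; apply: ge0_le_integral => //.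
- by move=> w _; rewrite lee_fin sqr_ge0.
- by move=> w _; exact: nd.
Qed.

Let L := lnrm P r F setT.

Let K_ge0 : 0 <= K. Proof. exact: ltW (var_cst_gt0 r_gt1). Qed.

Lemma var_sum_le n k a : At n a ->
  (\int[P]_(w in a) (vs n k w ^+ 2)%:E <= (K * L ^+ 2 * pr P a)%:E)%E.
Proof.
move=> Aa; have ma := atom_measurable afil Aa.
have [_] := var_sum_bound r_gt1 afil k LF Aa.
move=> /le_trans; apply; rewrite lee_fin -mulrA.
apply: (ler_wpM2l K_ge0); rewrite mulrC; apply: (ler_wpM2r (pr_ge0 P a)).
rewrite ler_sqr ?nnegrE ?lnrm_ge0//; exact: le_lnrm.
Qed.

Lemma riesz_partial0 w : u 0%N w = 0.
Proof. by rewrite riesz_partialE big_nil. Qed.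

Lemma riesz_partial_var n k a : At n a ->
  (\int[P]_(w in a) ((u (n + k)%N w - u n w) ^+ 2)%:E <=
   (K * L ^+ 2 * pr P a)%:E)%E.
Proof.
move=> Aa; apply: le_trans (var_sum_le k Aa); have ma := atom_measurable afil Aa.
apply: ge0_le_integral => //.
- by move=> w _; rewrite lee_fin sqr_ge0.
- apply/measurable_EFinP/measurable_funX/measurable_funB; apply: measurable_funTS;
    exact: measurable_riesz_partial.
- apply/measurable_EFinP/measurable_funX/measurable_funTS.
  exact: (measurable_var_sum _ _ afil).
- move=> w _; rewrite lee_fin -[leLHS]real_normK ?num_real//.
  by rewrite ler_sqr ?nnegrE ?var_sum_ge0// riesz_partial_dist.
Qed.

Lemma integrable_riesz_partial N : P.-integrable setT (EFin \o u N).
Proof.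
apply: sqr_integrable => //; first exact: measurable_riesz_partial.
(* On the root atom at level 0 the subtracted partial sum is [u 0 = 0], so the local estimate is a
   global bound on [u N]. *)
have := riesz_partial_var N (root_atom P afil).
rewrite (eq_integral (fun w => (u N w ^+ 2)%:E)); last first.
  by move=> w _; rewrite add0n riesz_partial0 subr0.
by move=> /le_lt_trans; apply; rewrite ltry.
Qed.

Lemma integrable_riesz_potential : P.-integrable setT (EFin \o G).
Proof.
apply: sqr_integrable => //; first exact: measurable_riesz_potential.
have := riesz_potential_var (root_atom P afil)
  (fun k => var_sum_le k (root_atom P afil)).
rewrite (eq_integral (fun w => (G w ^+ 2)%:E)); last first.
  by move=> w _; rewrite riesz_partial0 subr0.
by move=> /le_lt_trans; apply; rewrite ltry.
Qed.

(** For [N <= n] the partial sum is constant on [a]; otherwise its deviation from the value of [u n]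
    on [a] is [u N - u n], controlled by the variation below [a]. *)
Lemma riesz_partial_oscillation N n a : At n a -> exists m,
  (\int[P]_(w in a) ((u N w - m) ^+ 2)%:E <= (K * L ^+ 2 * pr P a)%:E)%E.
Proof.
move=> Aa; have [w0 aw0] := atom_nonempty afil Aa.
have [Nn|nN] := leqP N n.
  exists (u N w0); rewrite (eq_integral (cst 0%E)).
    by rewrite integral0 lee_fin (mulr_ge0 (mulr_ge0 K_ge0 (sqr_ge0 L)) (pr_ge0 P a)).
  move=> w; rewrite inE => aw.
  by rewrite (riesz_partial_cst Nn Aa aw aw0) subrr expr0n.
exists (u n w0); have := riesz_partial_var (N - n) Aa.
rewrite subnKC ?(ltnW nN)//; congr (_ <= _)%E.
apply: eq_integral => w; rewrite inE => aw.
by rewrite (riesz_partial_cst (leqnn n) Aa aw aw0).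
Qed.

Lemma riesz_potential_oscillation n a : At n a -> exists m,
  (\int[P]_(w in a) ((G w - m) ^+ 2)%:E <= (K * L ^+ 2 * pr P a)%:E)%E.
Proof.
move=> Aa; have [w0 aw0] := atom_nonempty afil Aa.
exists (u n w0).
have := riesz_potential_var Aa (fun k => var_sum_le k Aa); congr (_ <= _)%E.
apply: eq_integral => w; rewrite inE => aw.
by rewrite (riesz_partial_cst (leqnn n) Aa aw aw0).
Qed.

Lemma bmo_norm_le_of_oscillation h : P.-integrable setT (EFin \o h) ->
  (forall n a, At n a -> exists m,
    (\int[P]_(w in a) ((h w - m) ^+ 2)%:E <= (K * L ^+ 2 * pr P a)%:E)%E) ->
  (bmo_norm P Fs At h <= (Num.sqrt K * L)%:E)%E.
Proof.
move=> ih hosc; apply: (bmo_norm_le afil) => //.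
  by rewrite mulr_ge0 ?sqrtr_ge0 ?lnrm_ge0.
move=> n a e Aa pa e0; have [m hm] := hosc n a Aa; exists m.
apply: le_trans hm _; rewrite lee_fin exprMn sqr_sqrtr//.
by rewrite (ler_wpM2r (pr_ge0 P a))// lerDl ltW.
Qed.

Lemma BMO_riesz_partial N : BMO P Fs At (u N).
Proof.
split; first exact: integrable_riesz_partial.
apply: le_lt_trans (ltry (Num.sqrt K * L)).
apply: bmo_norm_le_of_oscillation; first exact: integrable_riesz_partial.
by move=> n a; exact: riesz_partial_oscillation.
Qed.

Lemma BMO_riesz_potential : BMO P Fs At G.
Proof.
split; first exact: integrable_riesz_potential.
apply: le_lt_trans (ltry (Num.sqrt K * L)).
apply: bmo_norm_le_of_oscillation; first exact: integrable_riesz_potential.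
by move=> n a; exact: riesz_potential_oscillation.
Qed.

(** Tails are small in mean square on atoms of level at least [N0]. Shallower atoms are cut into
    atoms of level [N], where the same bound is summed. *)
Lemma bmo_norm_riesz_small (e : R) : 0 < e ->
  \forall N \near \oo, (bmo_norm P Fs At (u N \- G)%R <= e%:E)%E.
Proof.
move=> e0; have e20 : 0 < e ^+ 2 by rewrite exprn_gt0.
have [N0 _ small] := var_sum_small r_gt1 afil LF e20.
exists N0 => // N /= N0N.
have GN n a : (N0 <= n)%N -> At n a ->
    (\int[P]_(w in a) ((G w - u n w) ^+ 2)%:E <= (e ^+ 2 * pr P a)%:E)%E.
  by move=> N0n Aa; apply: riesz_potential_var => // k; exact: small.
have mGu n a : measurable a ->
    measurable_fun a (fun w => ((G w - u n w) ^+ 2)%:E).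
  move=> ma; apply/measurable_EFinP/measurable_funX/measurable_funB; apply: measurable_funTS.
    exact: measurable_riesz_potential.
  exact: measurable_riesz_partial.
apply: (bmo_norm_le afil) => //; first exact: ltW.
  have := integrableB measurableT (integrable_riesz_partial N) integrable_riesz_potential.
  exact: eq_integrable.
move=> n a s Aa pa s0; have ma := atom_measurable afil Aa.
have les : e ^+ 2 * pr P a <= (e ^+ 2 + s) * pr P a.
  by rewrite (ler_wpM2r (pr_ge0 P a))// lerDl ltW.
have [Nn|nN] := leqP N n.
  have [w0 aw0] := atom_nonempty afil Aa.
  (* On an atom of level [n >= N] both [u N] and [u n] are constant, so with this constant the
     deviation is [u n - G]. *)
  exists (u N w0 - u n w0).
  apply: le_trans (_ : (e ^+ 2 * pr P a)%:E <= _)%E; last by rewrite lee_fin.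
  have := GN n a (leq_trans N0N Nn) Aa; congr (_ <= _)%E.
  apply: eq_integral => w; rewrite inE => aw /=.
  rewrite (riesz_partial_cst (leqnn n) Aa aw aw0).
  rewrite (riesz_partial_cst Nn Aa aw aw0) -sqrrN; congr (_ ^+ 2)%:E.
  lra.
exists 0.
have [c [cA tc mc ca cT]] := atom_children afil (ltnW nN) Aa.
apply: (integral_pieces_le (x := fun i => e ^+ 2 * pr P (c i)) mc tc cT).
- rewrite (_ : (fun w => _) = (fun w => ((G w - u N w) ^+ 2)%:E)); first exact: mGu.
  by apply/funext => w; rewrite subr0 /= -sqrrN opprB.
- by move=> w _; rewrite lee_fin sqr_ge0.
- move=> i; have [Ac|->] := cA i.
    have := GN N (c i) N0N Ac; congr (_ <= _)%E.
    by apply: eq_integral => w _; rewrite subr0 /= -sqrrN opprB.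
  by rewrite integral_set0 lee_fin mulr_ge0 ?sqr_ge0 ?pr_ge0.
- move=> k; rewrite -mulr_sumr; apply: le_trans les.
  by rewrite ler_wpM2l ?sqr_ge0// sum_pr_le.
Qed.

Lemma riesz_partial_bmo_cvg : bmo_cvg P Fs At (fun N => u N) G.
Proof.
split; [exact: BMO_riesz_partial|exact: BMO_riesz_potential|].
have b0 N := bmo_norm_ge0 P afil (u N \- G)%R.
have fin (e : R) N : (bmo_norm P Fs At (u N \- G)%R <= e%:E)%E ->
    bmo_norm P Fs At (u N \- G)%R \is a fin_num.
  by move=> h; rewrite ge0_fin_numE// (le_lt_trans h)// ltry.
apply/fine_cvgP; split.
  by apply: filterS (bmo_norm_riesz_small ltr01) => N; exact: fin.
apply/cvgr0Pnorm_le => e e0; apply: filterS (bmo_norm_riesz_small e0) => N h.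
by rewrite /= ger0_norm ?fine_ge0// -lee_fin fineK// (fin e).
Qed.

(** A BMO limit is determined only up to seminorm zero, so the bound is proved for an arbitrary
    limit [H]. Writing [H = u N - (u N - H)], the inequality [(x - y)^2 <= 2 x^2 + 2 y^2] produces
    the factor 2 in the constant. *)
Lemma bmo_limit_le H : bmo_cvg P Fs At (fun N => u N) H ->
  (bmo_norm P Fs At H <= (Num.sqrt (2 * K) * L)%:E)%E.
Proof.
move=> [_ [iH _] cvgH]; apply: (bmo_norm_le afil) => //.
  by rewrite mulr_ge0 ?sqrtr_ge0 ?lnrm_ge0.
move=> n a e Aa pa e0; have ma := atom_measurable afil Aa.
(* Chosen so that [2 * s ^+ 2 = e], the slack allowed by [bmo_norm_le]. *)
pose s := Num.sqrt (e / 2).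
have s0 : 0 < s by rewrite sqrtr_gt0 divr_gt0.
have [N bN] : exists N, (bmo_norm P Fs At (u N \- H)%R <= s%:E)%E.
  have /fine_cvgP[fin /cvgr0Pnorm_le /(_ _ s0) sm] := cvgH.
  have [N [fN sN]] := filter_ex (filterI fin sm).
  exists N; rewrite -(fineK fN) lee_fin; apply: le_trans sN; exact: ler_norm.
have iuH : P.-integrable setT (EFin \o (u N \- H)%R).
  have := integrableB measurableT (integrable_riesz_partial N) iH.
  exact: eq_integrable.
have [m1 h1] := bmo_norm_oscillation afil (ltW s0) iuH bN Aa pa.
have [m2 h2] := riesz_partial_oscillation N Aa.
have mu : measurable_fun a (u N).
  by apply: measurable_funTS; exact: measurable_riesz_partial.
have mH : measurable_fun a H.
  by apply: measurable_funTS; have /integrableP[/measurable_EFinP] := iH.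
have mq (f : T -> R) (m : R) : measurable_fun a f ->
    measurable_fun a (fun w => ((f w - m) ^+ 2)%:E).
  by move=> mf; apply/measurable_EFinP/measurable_funX/measurable_funB.
exists (m2 - m1).
have mq1 := mq _ m1 (measurable_funB mu mH); have mq2 := mq _ m2 mu.
apply: (@le_trans _ _ (2%:E * \int[P]_(w in a) ((u N w - m2) ^+ 2)%:E +
    2%:E * \int[P]_(w in a) (((u N \- H) w - m1) ^+ 2)%:E)%E).
  rewrite -!ge0_integralZl//; last 2 first.
  - by move=> w _; rewrite lee_fin sqr_ge0.
  - by move=> w _; rewrite lee_fin sqr_ge0.
  rewrite -ge0_integralD//; last 4 first.
  - by move=> w _; rewrite -EFinM lee_fin mulr_ge0// sqr_ge0.
  - exact: measurable_funeM.
  - by move=> w _; rewrite -EFinM lee_fin mulr_ge0// sqr_ge0.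
  - exact: measurable_funeM.
  apply: ge0_le_integral => //.
  - by move=> w _; rewrite lee_fin sqr_ge0.
  - exact: mq.
  - by apply: emeasurable_funD; exact: measurable_funeM.
  - move=> w _; rewrite -!EFinM -EFinD lee_fin /=.
    have := sqr_ge0 ((u N w - m2) + (u N w - H w - m1)).
    by move: (u N w) (H w) => x y; rewrite !expr2; lra.
apply: (@le_trans _ _ (2%:E * (K * L ^+ 2 * pr P a)%:E +
    2%:E * (s ^+ 2 * pr P a)%:E)%E).
  by apply: leeD; apply: lee_wpmul2l => //; rewrite lee_fin.
rewrite -!EFinM -EFinD lee_fin exprMn (sqr_sqrtr (mulr_ge0 (ler0n _ 2) K_ge0)).
rewrite (sqr_sqrtr (divr_ge0 (ltW e0) (ler0n _ 2))).
lra.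
Qed.

End Riesz.

(** * Lebesgue spaces and the uniform constant *)

Lemma Lfun_Lr d (T : measurableType d) (R : realType) (P : probability T R)
    (r : R) (F : T -> R) : 1 < r -> F \in Lfun P r%:E -> Lr P r F.
Proof.
move=> r1 LF; split; last exact: Lfun_integrable (ltW r1) LF.
by have := sub_Lfun_mfun LF; rewrite inE.
Qed.

Lemma Lnorm_lnrm d (T : measurableType d) (R : realType) (P : probability T R)
    (r : R) (F : T -> R) : Lr P r F ->
  ('N[P]_r%:E[EFin \o F] = (lnrm P r F setT)%:E)%E.
Proof.
move=> LF; by rewrite unlock /lnrm -poweR_EFin lpowE.
Qed.

Theorem theorem2p2 (R : realType) (r : R) (r_gt1 : 1 < r) :
  exists C : R,
  forall (d : measure_display) (T : measurableType d) (P : probability T R)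
    (Fs At : nat -> set_system T),
  atomic_filtration Fs At ->
  forall F : T -> R, F \in Lfun P r%:E ->
    (exists G : T -> R, bmo_cvg P Fs At (riesz_partial P r^-1 Fs At F) G) /\
    (forall G : T -> R, bmo_cvg P Fs At (riesz_partial P r^-1 Fs At F) G ->
       (bmo_norm P Fs At G <= C%:E * 'N[P]_r%:E[EFin \o F])%E).
Proof.
(* [var_cst r] is built from [r] alone, so the constant is fixed before the space and the
   filtration. *)
exists (Num.sqrt (2 * var_cst r)) => d T P Fs At afil F /(Lfun_Lr r_gt1) LF.
split.
  exists (riesz_potential P r Fs At F).
  exact: (riesz_partial_bmo_cvg r_gt1 afil LF).
move=> G cG; rewrite (Lnorm_lnrm LF) -EFinM.
exact: (bmo_limit_le r_gt1 afil LF cG).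
Qed.
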